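(* Let $\mathcal C$ be a cube with center $O$, and let $f\colon\mathcal C\to\mathbb{R}$ be convex on every pyramid having a face of $\mathcal C$ as base and $O$ as apex. Fix two opposite vertices $V,W$ of $\mathcal C$. Let $S$ be the union of the six edges of $\mathcal C$ meeting at $V$ or $W$, and let $Q$ be the union of the three main (space) diagonals of $\mathcal C$ joining the remaining six vertices. Then $$\operatorname{Avg}(f,\mathcal C)\le\frac12\operatorname{Avg}(f,S)+\frac12\operatorname{Avg}(f,Q).$$
   Context: $\operatorname{Avg}(f,\mathcal C)$ is the average over the cube with respect to volume; $\operatorname{Avg}(f,S)$ and $\operatorname{Avg}(f,Q)$ are averages over these unions of segments with respect to length. *)

(* Defs.v *)
From HB Require Import structures.
From mathcomp Require Import all_boot all_order all_algebra.
From mathcomp Require Import all_classical all_reals all_analysis.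
Set Implicit Arguments. Unset Strict Implicit. Unset Printing Implicit Defensive.
Import Order.TTheory GRing.Theory Num.Theory.
Import numFieldNormedType.Exports.
Local Open Scope classical_set_scope.
Local Open Scope ring_scope.

Section Defs.
Variable R : realType.

Definition pt := (R * R * R)%type.

Definition padd (p q : pt) : pt := (p.1.1 + q.1.1, p.1.2 + q.1.2, p.2 + q.2).
Definition pscale (a : R) (p : pt) : pt := (a * p.1.1, a * p.1.2, a * p.2).
Definition psub (p q : pt) : pt := padd p (pscale (-1) q).
Definition pdot (p q : pt) : R := p.1.1 * q.1.1 + p.1.2 * q.1.2 + p.2 * q.2.
Definition plen (p : pt) : R := Num.sqrt (pdot p p).

Definition cpt (c e1 e2 e3 : pt) (x1 x2 x3 : R) : pt :=
  padd c (padd (pscale x1 e1) (padd (pscale x2 e2) (pscale x3 e3))).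

(* (c, e1, e2, e3) describes a cube: center c, half-edge vectors e1 e2 e3
   pairwise orthogonal of common length a > 0. *)
Definition is_cube_frame (c e1 e2 e3 : pt) : Prop :=
  exists a : R, 0 < a /\
    pdot e1 e1 = a ^+ 2 /\ pdot e2 e2 = a ^+ 2 /\ pdot e3 e3 = a ^+ 2 /\
    pdot e1 e2 = 0 /\ pdot e1 e3 = 0 /\ pdot e2 e3 = 0.

Definition cube (c e1 e2 e3 : pt) : set pt :=
  [set p | exists x1 x2 x3 : R,
     [/\ -1 <= x1 <= 1, -1 <= x2 <= 1, -1 <= x3 <= 1 & p = cpt c e1 e2 e3 x1 x2 x3]].

Definition cube_face (c e1 e2 e3 : pt) (i : 'I_3) (sg : R) : set pt :=
  [set p | exists x1 x2 x3 : R,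
     [/\ -1 <= x1 <= 1, -1 <= x2 <= 1, -1 <= x3 <= 1,
         nth 0 [:: x1; x2; x3] i = sg & p = cpt c e1 e2 e3 x1 x2 x3]].

Definition pyramid (c : pt) (F : set pt) : set pt :=
  [set p | exists t y, 0 <= t <= 1 /\ F y /\
     p = padd (pscale (1 - t) c) (pscale t y)].

Definition convex_on (P : set pt) (f : pt -> R) : Prop :=
  forall x y t, P x -> P y -> 0 <= t <= 1 ->
    f (padd (pscale t x) (pscale (1 - t) y)) <= t * f x + (1 - t) * f y.

Definition leb3 := ((@lebesgue_measure R \x @lebesgue_measure R) \x
                    @lebesgue_measure R)%E.

Definition avg_vol (f : pt -> R) (D : set pt) : R :=
  (\int[leb3]_(x in D) f x) / fine (leb3 D).

Definition seg_integral (f : pt -> R) (P Q : pt) : R :=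
  plen (psub Q P) *
  \int[@lebesgue_measure R]_(t in `[0, 1]) f (padd P (pscale t (psub Q P))).

(* Average with respect to length over a finite union of segments
   (the segments below meet only in finitely many points) *)
Definition avg_segs (f : pt -> R) (segs : seq (pt * pt)) : R :=
  (\sum_(s <- segs) seg_integral f s.1 s.2) /
  (\sum_(s <- segs) plen (psub s.2 s.1)).

End Defs.

(* Main.v *)
Require Import Defs.
From HB Require Import structures.
From mathcomp Require Import all_boot all_order all_algebra.
From mathcomp Require Import all_classical all_reals all_analysis.
From mathcomp Require Import measurable_realfun.
From mathcomp Require Import ring lra.
Import Order.TTheory GRing.Theory Num.Theory.
Import numFieldNormedType.Exports.
Local Open Scope classical_set_scope.
Local Open Scope ring_scope.

(** The cube is cut into twelve tetrahedra of equal volume, each with the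
    center [O] as a vertex, an edge of [S] as an edge, and half a diagonal of
    [Q] as the opposite edge.  On a tetrahedron [f] is convex, and a point is
    [s X + (1 - s) Y] with [X], [Y] on the two opposite edges, so
    [f <= s f(X) + (1 - s) f(Y)]; integrating in the coordinates
    [(position of X, position of Y, s)] gives the average of the averages of
    [f] over the two opposite edges.  Each edge of [S] and each half diagonal
    occurs in exactly two of the tetrahedra.  Linear changes of variables only
    need that a linear bijection multiplies the volume by some constant, by
    uniqueness of translation-invariant measures; the constants cancel. *)

(** The tetrahedra come from the faces. A face contains exactly one of [V], [W], say [V]; its
    diagonal from [V] ends at a neighbour of [W] and cuts the face into two triangles. Each triangle
    has a side in [S], opposite to a vertex that is an end of a diagonal in [Q], and its cone from
    [O] stays inside one pyramid. The obstacle is regularity. Convexity on closed pyramids allows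
    [f] to jump on the surface of the cube, where the edges of [S] lie, and segments are null sets,
    so measurability up to null sets would not do. Borel measurability and boundedness on each
    closed tetrahedron are therefore derived from convexity alone. The weight 1/2 arises because the
    slice at parameter [s] is a rectangle of area proportional to [s (1 - s)], a density for which
    [s] and [1 - s] have the same mean. The integral bound is first proved for nonnegative
    functions, where it is enough that the tetrahedra cover the cube. Adding a constant then reaches
    every [f], since the volumes match exactly: 2/3 is a twelfth of 8. *)

(** * Images of measures, product measures and translations *)

Lemma ge0_integral_equivariant {d} {T : measurableType d} {R : realType}
    (mu : {measure set T -> \bar R}) (phi : T -> T) (k : R) (D : set T)
    (f : T -> \bar R) :
  measurable_fun setT phi -> 0 <= k ->
  (forall A, measurable A -> mu (phi @^-1` A) = k%:E * mu A)%E ->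
  measurable D -> measurable_fun D f -> (forall x, D x -> 0 <= f x)%E ->
  (\int[mu]_(x in phi @^-1` D) f (phi x) = k%:E * \int[mu]_(x in D) f x)%E.
Proof.
move=> mphi k0 muk mD mf f0.
rewrite -(ge0_integral_pushforward mphi mu mD mf); last first.
  by move=> y /set_mem; exact: f0.
have := @ge0_integral_mscale _ T R mu D mD (NngNum k0) f mf f0 => /= <-.
by apply: eq_measure_integral => A mA _; exact: muk.
Qed.

(** The image measure multiplied by the absolute value of [a] gives half-open intervals their
    length, and these intervals determine Lebesgue measure. *)
Lemma lebesgue_measure_affine {R : realType} (a b : R) (A : set R) :
  a != 0 -> measurable A ->
  (@lebesgue_measure R [set x | A (a * x + b)%R] = `|a^-1|%:E * lebesgue_measure A)%E.
Proof.
move=> a0 mA.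
have mphi : measurable_fun [set: measurableTypeR R]
    ((fun x => a * x + b) : measurableTypeR R -> measurableTypeR R).
  exact: measurable_funD.
pose m : {measure set (measurableTypeR R) -> \bar R} :=
  mscale (NngNum (normr_ge0 a)) (pushforward (@lebesgue_measure R)
    ((fun x => a * x + b) : measurableTypeR R -> measurableTypeR R)).
have mE B : m mphi B = (`|a|%:E * @lebesgue_measure R [set x | B (a * x + b)%R])%E by [].
have -> : lebesgue_measure A = m mphi A.
  apply: lebesgue_measure_unique => // X /ocitvP[->|[[u v] /= uv ->]].
    by rewrite !measure0.
  rewrite mE lebesgue_measure_itv/= lte_fin uv.
  have [a_gt0|a_lt0|] := ltgtP 0 a; last by move/esym/eqP; rewrite (negbTE a0).
  - rewrite [X in lebesgue_measure X](_ : _ =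
        [set` `]((u - b) / a), ((v - b) / a)]]); last first.
      apply/seteqP; split => x /=; rewrite !in_itv/= ltr_pdivrMr// ler_pdivlMr//;
        by move=> /andP[h1 h2]; apply/andP; split; lra.
    rewrite lebesgue_measure_itv/= lte_fin ltr_pM2r ?invr_gt0// ltrD2r uv.
    by rewrite -EFinD -EFinM gtr0_norm//; congr EFin; field; rewrite gt_eqF.
  (* A negative slope reverses the interval, so the closed end moves to the left. *)
  - rewrite [X in lebesgue_measure X](_ : _ =
        [set` `[((v - b) / a), ((u - b) / a)[]); last first.
      apply/seteqP; split => x /=; rewrite !in_itv/= ltr_ndivlMr// ler_ndivrMr//;
        by move=> /andP[h1 h2]; apply/andP; split; lra.
    rewrite lebesgue_measure_itv/= lte_fin ltr_nM2r ?invr_lt0// ltrD2r uv.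
    by rewrite -EFinD -EFinM ltr0_norm//; congr EFin; field; rewrite lt_eqF.
rewrite mE muleA -EFinM -normrM mulVf// normr1 mul1e//.
Qed.

Lemma sigma_finite_product {d1 d2} {T1 : measurableType d1}
    {T2 : measurableType d2} {R : realType}
    (m1 : {sigma_finite_measure set T1 -> \bar R})
    (m2 : {sigma_finite_measure set T2 -> \bar R}) :
  sigma_finite setT (m1 \x m2)%E.
Proof.
have [F TF Foo] := sigma_finiteT m1; have [G TG Goo] := sigma_finiteT m2.
exists (fun k => if @unpickle (nat * nat)%type k is Some (i, j)
  then F i `*` G j else set0).
  apply/seteqP; split => // -[x y] _.
  have [i _ Fx] : (\bigcup_k F k) x by rewrite -TF.
  have [j _ Gy] : (\bigcup_k G k) y by rewrite -TG.
  by exists (pickle (i, j)) => //; rewrite pickleK.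
move=> k; case: unpickle => [[i j]|]; last by split; rewrite ?measure0.
have [mF Fi] := Foo i; have [mG Gj] := Goo j; split; first exact: measurableX.
by rewrite product_measure1E// lte_mul_pinfty// ge0_fin_numE.
Qed.

(* The library's sigma-finite instance of [\x] is shadowed by the one for
   probability measures, so that iterated products need constants of their own. *)
Definition leb2 (R : realType) := (@lebesgue_measure R \x @lebesgue_measure R)%E.

HB.instance Definition _ (R : realType) := Measure.on (@leb2 R).

HB.instance Definition _ (R : realType) := Measure_isSigmaFinite.Build _ _ _
  (@leb2 R) (sigma_finite_product (@lebesgue_measure R) (@lebesgue_measure R)).

HB.instance Definition _ (R : realType) := Measure.on (@leb3 R).

HB.instance Definition _ (R : realType) := Measure_isSigmaFinite.Build _ _ _
  (@leb3 R) (sigma_finite_product (@leb2 R) (@lebesgue_measure R)).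

(** The image of the product measure agrees with the product measure on rectangles, hence
    everywhere. Applied twice, this carries translation invariance from the line to space. *)
Lemma product_measure_preimage {d1 d2} {T1 : measurableType d1}
    {T2 : measurableType d2} {R : realType}
    (m1 : {sigma_finite_measure set T1 -> \bar R})
    (m2 : {sigma_finite_measure set T2 -> \bar R})
    (phi1 : T1 -> T1) (phi2 : T2 -> T2) (X : set (T1 * T2)) :
  measurable_fun setT phi1 -> measurable_fun setT phi2 ->
  (forall A, measurable A -> m1 (phi1 @^-1` A) = m1 A) ->
  (forall A, measurable A -> m2 (phi2 @^-1` A) = m2 A) ->
  measurable X ->
  (m1 \x m2)%E ((fun p => (phi1 p.1, phi2 p.2)) @^-1` X) = (m1 \x m2)%E X.
Proof.
move=> mphi1 mphi2 phi1m phi2m mX.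
have mphi : measurable_fun [set: T1 * T2] (fun p => (phi1 p.1, phi2 p.2)).
  apply: measurable_fun_pair.
    exact: (measurableT_comp mphi1 measurable_fst).
  exact: (measurableT_comp mphi2 measurable_snd).
pose m : {measure set (T1 * T2) -> \bar R} :=
  pushforward (m1 \x m2)%E (fun p => (phi1 p.1, phi2 p.2)).
rewrite [RHS](product_measure_unique (m' := m mphi))// => A B mA mB.
rewrite -phi1m// -phi2m// -product_measure1E//.
- by rewrite -[X in measurable X]setTI; exact: mphi1.
- by rewrite -[X in measurable X]setTI; exact: mphi2.
Qed.

Lemma measurable_pt_fun {d} {T : measurableType d} {R : realType}
    (g : T -> pt R) :
  measurable_fun setT (fun t => (g t).1.1) -> measurable_fun setT (fun t => (g t).1.2) ->
  measurable_fun setT (fun t => (g t).2) -> measurable_fun setT g.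
Proof.
move=> m1 m2 m3; have -> : g = fun t => ((g t).1.1, (g t).1.2, (g t).2).
  by apply/funext => t; case: (g t) => -[].
by apply: measurable_fun_pair => //; exact: measurable_fun_pair.
Qed.

Lemma measurable_fst_fst {R : realType} :
  measurable_fun setT (fun p : pt R => p.1.1).
Proof. exact: (measurableT_comp measurable_fst measurable_fst). Qed.

Lemma measurable_fst_snd {R : realType} :
  measurable_fun setT (fun p : pt R => p.1.2).
Proof. exact: (measurableT_comp measurable_snd measurable_fst). Qed.

Lemma measurable_padd {d} {T : measurableType d} {R : realType} (g h : T -> pt R) :
  measurable_fun setT g -> measurable_fun setT h ->
  measurable_fun setT (fun t => padd (g t) (h t)).
Proof.
move=> mg mh; apply: measurable_pt_fun => /=; apply: measurable_funD.
- exact: (measurableT_comp measurable_fst_fst mg).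
- exact: (measurableT_comp measurable_fst_fst mh).
- exact: (measurableT_comp measurable_fst_snd mg).
- exact: (measurableT_comp measurable_fst_snd mh).
- exact: (measurableT_comp measurable_snd mg).
- exact: (measurableT_comp measurable_snd mh).
Qed.

Lemma measurable_pscale {d} {T : measurableType d} {R : realType} (k : T -> R)
    (g : T -> pt R) :
  measurable_fun setT k -> measurable_fun setT g ->
  measurable_fun setT (fun t => pscale (k t) (g t)).
Proof.
move=> mk mg; apply: measurable_pt_fun => /=; apply: measurable_funM => //.
- exact: (measurableT_comp measurable_fst_fst mg).
- exact: (measurableT_comp measurable_fst_snd mg).
- exact: (measurableT_comp measurable_snd mg).
Qed.

Lemma measurable_preimage {d d'} {T : measurableType d} {U : measurableType d'}
    (g : T -> U) (A : set U) :
  measurable_fun setT g -> measurable A -> measurable (g @^-1` A).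
Proof. by move=> mg mA; rewrite -[X in measurable X]setTI; exact: mg. Qed.

Lemma leb3_translation {R : realType} (v : pt R) (A : set (pt R)) :
  measurable A -> leb3 [set p | A (padd p v)] = leb3 A.
Proof.
have mshift (r : R) : measurable_fun setT (fun x : R => x + r).
  exact: measurable_funD.
have shift1 (r : R) (B : set R) : measurable B ->
    @lebesgue_measure R ((fun x => x + r) @^-1` B) = lebesgue_measure B.
  move=> mB; have := lebesgue_measure_affine 1 r B (oner_neq0 _) mB.
  rewrite invr1 normr1 mul1e => <-; congr lebesgue_measure.
  by apply/seteqP; split => x /=; rewrite mul1r.
move=> mA; apply: (product_measure_preimage (@leb2 R) (@lebesgue_measure R)
  (fun q => (q.1 + v.1.1, q.2 + v.1.2)) (fun x => x + v.2) A) => //.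
- apply: measurable_fun_pair.
    exact: (measurableT_comp (mshift _) measurable_fst).
  exact: (measurableT_comp (mshift _) measurable_snd).
- exact: mshift.
- move=> B mB; exact: (product_measure_preimage (@lebesgue_measure R)
    (@lebesgue_measure R) (fun x => x + v.1.1) (fun x => x + v.1.2) B
    (mshift _) (mshift _) (shift1 _) (shift1 _) mB).
- by move=> B mB; exact: shift1.
Qed.

(** Tonelli for sets: [\x] is built from the sections in the other direction, and the two iterated
    integrals agree on rectangles. *)
Lemma product_measure1_ysection {d1 d2} {T1 : measurableType d1}
    {T2 : measurableType d2} {R : realType}
    (m1 : {sigma_finite_measure set T1 -> \bar R})
    (m2 : {sigma_finite_measure set T2 -> \bar R}) (E : set (T1 * T2)) :
  measurable E ->
  ((m1 \x m2) E = \int[m2]_y m1 [set x | E (x, y)])%E.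
Proof.
move=> mE; rewrite (product_measure_unique (m' := (m1 \x^ m2)%E))//.
  rewrite /product_measure2; apply: eq_integral => y _ /=; congr (m1 _).
  by apply/seteqP; split => x /=; rewrite /ysection /= in_setE.
by move=> B C mB mC; exact: product_measure2E.
Qed.

(** * Uniqueness, up to a constant, of translation-invariant measures *)

Section haar.
Context {d} {T : measurableType d} {R : realType}.
Variable mu : {sigma_finite_measure set T -> \bar R}.
Variables (add : T -> T -> T) (opp : T -> T).
Hypothesis addC : commutative add.
Hypothesis addK : forall v p, add (add p v) (opp v) = p.
Hypothesis addBB : forall x y, add x (opp (add y x)) = opp y.
Hypothesis madd : measurable_fun setT (fun z : T * T => add z.1 z.2).
Hypothesis mopp : measurable_fun setT opp.
Hypothesis mu_translation : forall v (A : set T), measurable A ->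
  mu [set p | A (add p v)] = mu A.

Lemma product_measure_section (phi : T -> T) (A : set T) (E : set (T * T))
    (c : \bar R) :
  measurable_fun setT phi -> measurable A -> (0 <= c)%E ->
  (forall x, A (phi x) -> mu [set y | E (x, y)] = c) ->
  (forall x, ~ A (phi x) -> [set y | E (x, y)] = set0) ->
  ((mu \x mu)%E E = mu (phi @^-1` A) * c)%E.
Proof.
move=> mphi mA c0 EA EnA; rewrite /product_measure1.
transitivity (\int[mu]_x (c * (\1_(phi @^-1` A) x)%:E))%E.
  apply: eq_integral => x _ /=.
  rewrite indicE -[xsection E x]/[set y | (x, y) \in E].
  have -> : [set y | (x, y) \in E] = [set y | E (x, y)].
    by apply/seteqP; split=> y /=; rewrite in_setE.
  have [Ax|Ax] := pselect (A (phi x)).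
    by rewrite EA// mem_set// mule1.
  by rewrite EnA// measure0 memNset// mule0.
have mphiA : measurable (phi @^-1` A) by exact: measurable_preimage.
rewrite ge0_integralZl//; last exact/measurable_EFinP/measurable_indic.
by rewrite integral_indic// setIT muleC.
Qed.

(* Tonelli applied to the indicator of [A (phi x) /\ K (phi x + y)]; when
   integrating in [x] first, translate [x] by [- L y]. *)
Lemma equivariant_opp (phi L : T -> T) (A K : set T) :
  measurable_fun setT phi ->
  (forall x y, phi (add x (L y)) = add (phi x) y) ->
  measurable A -> measurable K ->
  (mu (phi @^-1` A) * mu K = mu (phi @^-1` K) * mu (opp @^-1` A))%E.
Proof.
move=> mphi phiL mA mK.
have mphi1 : measurable_fun setT (fun z : T * T => phi z.1).
  exact: (measurableT_comp mphi measurable_fst).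
have msub : measurable_fun setT (fun z : T * T => add (phi z.1) (opp z.2)).
  exact: (measurableT_comp madd (measurable_fun_pair mphi1
    (measurableT_comp mopp measurable_snd))).
have maddp : measurable_fun setT (fun z : T * T => add (phi z.1) z.2).
  exact: (measurableT_comp madd (measurable_fun_pair mphi1 measurable_snd)).
pose E1 := [set z : T * T | A (phi z.1) /\ K (add (phi z.1) z.2)].
(* [E2] is [E1] with [x] replaced by [x - L y]; for fixed [y] the two sections are translates of
   each other. *)
pose E2 := [set z : T * T | K (phi z.1) /\ A (add (phi z.1) (opp z.2))].
have mE1 : measurable E1.
  apply: measurableI; first exact: (measurable_preimage (fun z => phi z.1)).
  exact: (measurable_preimage _ K maddp).
have mE2 : measurable E2.
  apply: measurableI; first exact: (measurable_preimage (fun z => phi z.1)).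
  exact: (measurable_preimage _ A msub).
have -> : (mu (phi @^-1` A) * mu K = (mu \x mu) E1)%E.
  rewrite (product_measure_section phi A E1 (mu K))//.
  - move=> x Ax; rewrite -(mu_translation (phi x) K mK); congr (mu _).
    by apply/seteqP; split => y /=; rewrite /E1 /= (addC y) // => -[].
  - by move=> x nAx; apply/seteqP; split => y //= -[].
have -> : (mu (phi @^-1` K) * mu (opp @^-1` A) = (mu \x mu) E2)%E.
  rewrite (product_measure_section phi K E2 (mu (opp @^-1` A)))//.
  (* Translating [y] by [phi x] turns [phi x - y] into [- y]; this is where [opp] enters. *)
  - move=> x Kx; rewrite -(mu_translation (phi x) [set y | E2 (x, y)]).
      by congr (mu _); apply/seteqP; split => y; rewrite /E2 /= addBB// => -[_].
    exact: (measurable_preimage (fun y => (x, y)) E2 (pair1_measurable x) mE2).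
  - by move=> x nKx; apply/seteqP; split => y //= -[].
rewrite !product_measure1_ysection//; apply: eq_integral => y _.
rewrite -(mu_translation (L y) [set x | E2 (x, y)]); last first.
  exact: (measurable_preimage (fun x => (x, y)) E2 (pair2_measurable y) mE2).
congr (mu _); apply/seteqP; split => x; rewrite /E1 /E2 /= phiL addK.
  by move=> [].
by move=> [].
Qed.

(** With the identity for [phi], [equivariant_opp] shows that [opp] preserves [mu]; for general
    [phi] it then yields the factor [c], the measure of the preimage of [K]. Evaluated at the
    preimage of [K] under [psi], the scaling law writes [mu K = 1] as [c] times another measure, so
    [c] is neither zero nor infinite. *)
Lemma equivariant_scaling (phi psi L M : T -> T) (K : set T) :
  measurable_fun setT phi -> measurable_fun setT psi -> cancel phi psi ->
  (forall x y, phi (add x (L y)) = add (phi x) y) ->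
  (forall x y, psi (add x (M y)) = add (psi x) y) ->
  measurable K -> (mu K = 1)%E ->
  exists2 c : R, 0 < c &
    forall A, measurable A -> mu (phi @^-1` A) = (c%:E * mu A)%E.
Proof.
move=> mphi mpsi phiK phiL psiM mK K1.
have mu_opp (A : set T) : measurable A -> mu (opp @^-1` A) = mu A.
  move=> mA; have := equivariant_opp (fun x => x) (fun x => x) A K
    (@measurable_id _ _ _) (fun _ _ => erefl) mA mK.
  by rewrite !preimage_id K1 mule1 mul1e.
have scale g L' : measurable_fun setT g ->
    (forall x y, g (add x (L' y)) = add (g x) y) ->
    forall A, measurable A -> (mu (g @^-1` A) = mu (g @^-1` K) * mu A)%E.
  move=> mg gL A mA; rewrite -(mu_opp A mA).
  by rewrite -(equivariant_opp g L' A K mg gL mA mK) K1 mule1.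
have phi_psi : (mu (phi @^-1` K) * mu (psi @^-1` K) = 1)%E.
  rewrite -(scale phi L)//; last exact: measurable_preimage.
  by rewrite -[X in mu X](_ : K = _)// -comp_preimage//;
    apply/seteqP; split => x /=; rewrite phiK.
have c0 : (0 < mu (phi @^-1` K))%E.
  rewrite lt0e measure_ge0 andbT; apply/eqP => c0.
  by move: phi_psi; rewrite c0 mul0e => /eqP; rewrite lt_eqF// lte01.
have d0 : (0 < mu (psi @^-1` K))%E.
  rewrite lt0e measure_ge0 andbT; apply/eqP => d0.
  by move: phi_psi; rewrite d0 mule0 => /eqP; rewrite lt_eqF// lte01.
have cfin : mu (phi @^-1` K) \is a fin_num.
  rewrite ge0_fin_numE ?ltW// ltey; apply/eqP => coo.
  by move: phi_psi; rewrite coo gt0_mulye.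
exists (fine (mu (phi @^-1` K))); first by rewrite fine_gt0// c0 -ge0_fin_numE ?ltW.
by move=> A mA; rewrite fineK// -(scale phi L).
Qed.
End haar.

Lemma paddC {R : realType} (p q : pt R) : padd p q = padd q p.
Proof. by rewrite /padd addrC (addrC p.1.2) (addrC p.2). Qed.

Lemma leb3_box {R : realType} (I1 I2 I3 : interval R) :
  leb3 [set p : pt R | [/\ p.1.1 \in I1, p.1.2 \in I2 & p.2 \in I3]] =
  (lebesgue_measure [set` I1] * lebesgue_measure [set` I2] *
   lebesgue_measure [set` I3])%E.
Proof.
have -> : [set p : pt R | [/\ p.1.1 \in I1, p.1.2 \in I2 & p.2 \in I3]] =
    (([set` I1] `*` [set` I2]) `*` [set` I3]).
  by apply/seteqP; split => -[[x y] z] /=; [move=> []|move=> [[]]].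
have m (I : interval R) : measurable ([set` I] : set (measurableTypeR R)).
  exact: measurable_itv.
have E2 := product_measure1E (@lebesgue_measure R) (@lebesgue_measure R)
  (m I1) (m I2).
have E3 := product_measure1E (@leb2 R) (@lebesgue_measure R)
  (measurableX (m I1) (m I2)) (m I3).
exact: etrans E3 (congr1 (fun x => x * _)%E E2).
Qed.

(** [L] and [M] stand for the inverses of the linear parts of [phi] and [psi]: equivariance under
    translations replaces any determinant. The reference set of measure one is the unit cube. *)
Lemma leb3_scaling {R : realType} (phi psi L M : pt R -> pt R) :
  measurable_fun setT phi -> measurable_fun setT psi -> cancel phi psi ->
  (forall x y, phi (padd x (L y)) = padd (phi x) y) ->
  (forall x y, psi (padd x (M y)) = padd (psi x) y) ->
  exists2 k : R, 0 < k &
    forall A, measurable A -> leb3 (phi @^-1` A) = (k%:E * leb3 A)%E.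
Proof.
move=> mphi mpsi phiK phiL psiM.
pose K := [set p : pt R | [/\ p.1.1 \in `[0, 1], p.1.2 \in `[0, 1] & p.2 \in `[0, 1]]].
have mK : measurable K.
  rewrite (_ : K = ((`[0, 1]%classic `*` `[0, 1]%classic) `*` `[0, 1]%classic)).
    by apply: measurableX => //; exact: measurableX.
  by apply/seteqP; split => -[[x y] z] /=; [move=> []|move=> [[]]].
apply: (@equivariant_scaling _ _ R (@leb3 R) (@padd R) (pscale (-1))
  _ _ _ _ _ _ phi psi L M K) => //.
- exact: paddC.
- by move=> [[? ?] ?] [[? ?] ?]; rewrite /padd /pscale /=; congr (_, _, _); ring.
- by move=> [[? ?] ?] [[? ?] ?]; rewrite /padd /pscale /=; congr (_, _, _); ring.
- exact: (measurable_padd _ _ measurable_fst measurable_snd).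
- exact: (measurable_pscale (fun=> -1) _ (measurable_cst _) (@measurable_id _ _ _)).
- exact: leb3_translation.
- by rewrite [LHS]leb3_box !lebesgue_measure_itv/= lte_fin ltr01 sube0 !mule1.
Qed.

(** * Convex functions on a model simplex: bounds and measurability *)

(** The tetrahedron whose opposite edges run from [(0, 0, 1)] to [(1, 0, 1)] and from [(0, 0, 0)] to
    [(0, 1, 0)]. Its slice at height [s] is a rectangle with sides [s] and [1 - s], parallel to
    these edges. *)
Definition simplex (R : realType) : set (pt R) :=
  [set p | [/\ 0 <= p.1.1, p.1.1 <= p.2, 0 <= p.1.2 & p.1.2 <= 1 - p.2]].

Lemma simplex_convex_le {R : realType} (h : pt R -> R) (p : pt R) :
  convex_on (simplex R) h -> simplex R p ->
  h p <= p.2 * h (p.1.1 / p.2, 0, 1) + (1 - p.2) * h (0, p.1.2 / (1 - p.2), 0).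
Proof.
case: p => -[a g] s hconv /= [/= a0 a_s g0 gs].
have s01 : 0 <= s <= 1 by apply/andP; split; lra.
have /andP[s0 s1] := s01.
(* For [s = 0] the quotient is 0 by convention, which is harmless: [a] vanishes there as well. The
   same holds for [g] when [s = 1]. *)
have as1 : 0 <= a / s <= 1.
  rewrite divr_ge0//=; have [->|s_neq0] := eqVneq s 0; first by rewrite invr0 mulr0.
  by rewrite ler_pdivrMr ?mul1r// lt_neqAle eq_sym s_neq0.
have gs1 : 0 <= g / (1 - s) <= 1.
  rewrite divr_ge0//=; last by lra.
  have [->|s_neq1] := eqVneq (1 - s) 0; first by rewrite invr0 mulr0.
  rewrite ler_pdivrMr ?mul1r//; lra.
have aE : s * (a / s) = a.
  have [s_eq0|s_neq0] := eqVneq s 0; last by field.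
  by rewrite s_eq0 mul0r; lra.
have gE : (1 - s) * (g / (1 - s)) = g.
  have [s_eq1|s_neq1] := eqVneq (1 - s) 0; last by rewrite mulrC divfK.
  by rewrite s_eq1 mul0r; lra.
rewrite (_ : (a, g, s) = padd (pscale s (a / s, 0, 1))
    (pscale (1 - s) (0, g / (1 - s), 0))).
  by apply: hconv => //; rewrite /simplex /=; split; lra.
rewrite /padd /pscale /= aE gE; congr (_, _, _); ring.
Qed.

(** The largest of the four vertex values is a bound: convexity gives it first on the two opposite
    edges, and [simplex_convex_le] spreads it to the whole simplex. *)
Lemma simplex_convex_bounded {R : realType} (h : pt R -> R) :
  convex_on (simplex R) h -> exists M : R, forall p, simplex R p -> h p <= M.
Proof.
move=> hconv; pose M0 := Num.max (h (1, 0, 1)) (h (0, 0, 1)).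
pose M1 := Num.max (h (0, 1, 0)) (h (0, 0, 0)).
have hM0 a : 0 <= a <= 1 -> h (a, 0, 1) <= M0.
  move=> /andP[a0 a1]; rewrite (_ : (a, 0, 1) = padd (pscale a (1, 0, 1))
    (pscale (1 - a) (0, 0, 1))); last first.
    by rewrite /padd /pscale /=; congr (_, _, _); ring.
  apply: le_trans (hconv _ _ a _ _ _) _; rewrite ?a0 ?a1//; try by split => /=; lra.
  have m1 : h (1, 0, 1) <= M0 by rewrite le_max lexx.
  have m2 : h (0, 0, 1) <= M0 by rewrite le_max lexx orbT.
  by nra.
have hM1 g : 0 <= g <= 1 -> h (0, g, 0) <= M1.
  move=> /andP[g0 g1]; rewrite (_ : (0, g, 0) = padd (pscale g (0, 1, 0))
    (pscale (1 - g) (0, 0, 0))); last first.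
    by rewrite /padd /pscale /=; congr (_, _, _); ring.
  apply: le_trans (hconv _ _ g _ _ _) _; rewrite ?g0 ?g1//; try by split => /=; lra.
  have m1 : h (0, 1, 0) <= M1 by rewrite le_max lexx.
  have m2 : h (0, 0, 0) <= M1 by rewrite le_max lexx orbT.
  by nra.
exists (Num.max M0 M1) => -[[a g] s] ps.
apply: le_trans (simplex_convex_le _ _ hconv ps) _.
case: ps => /= a0 a_s g0 gs.
have m0 : h (a / s, 0, 1) <= Num.max M0 M1.
  rewrite le_max hM0// divr_ge0//=; last by lra.
  have [->|s_neq0] := eqVneq s 0; first by rewrite invr0 mulr0.
  by rewrite ler_pdivrMr ?mul1r// lt_neqAle eq_sym s_neq0; lra.
have m1 : h (0, g / (1 - s), 0) <= Num.max M0 M1.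
  rewrite le_max hM1 ?orbT// divr_ge0//=; last by lra.
  have [->|s_neq1] := eqVneq (1 - s) 0; first by rewrite invr0 mulr0.
  by rewrite ler_pdivrMr ?mul1r//; lra.
by have s1 : s <= 1 by [lra]; have s0 : 0 <= s by [lra]; nra.
Qed.

(** The four bounded expressions are the barycentric weights for [(1, 0, 1)], [(0, 0, 1)],
    [(0, 1, 0)] and [(0, 0, 0)]. Rational bounds make the family countable. *)
Definition subsimplex (R : realType) (c : rat * rat * rat * rat) : set (pt R) :=
  [set p | [/\ simplex R p, ratr c.1.1.1 <= p.1.1, ratr c.1.1.2 <= p.2 - p.1.1,
    ratr c.1.2 <= p.1.2 & ratr c.2 <= 1 - p.2 - p.1.2]].

Lemma measurable_ge_preimage {d} {T : measurableType d} {R : realType}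
    (g : T -> R) (r : R) :
  measurable_fun setT g -> measurable [set t | r <= g t].
Proof.
move=> mg; rewrite (_ : [set t | r <= g t] = g @^-1` `[r, +oo[%classic).
  exact: measurable_preimage.
by apply/seteqP; split => t /=; rewrite in_itv/= andbT.
Qed.

Lemma measurable_weights {R : realType} (r : R) :
  [/\ measurable [set p : pt R | r <= p.1.1],
      measurable [set p : pt R | r <= p.2 - p.1.1],
      measurable [set p : pt R | r <= p.1.2] &
      measurable [set p : pt R | r <= 1 - p.2 - p.1.2]].
Proof.
have mb : measurable_fun setT (fun p : pt R => p.2 - p.1.1).
  by apply: measurable_funB; [exact: measurable_snd|exact: measurable_fst_fst].
have md : measurable_fun setT (fun p : pt R => 1 - p.2 - p.1.2).
  apply: measurable_funB; last exact: measurable_fst_snd.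
  by apply: measurable_funB => //; exact: measurable_snd.
split.
- exact: (measurable_ge_preimage _ _ measurable_fst_fst).
- exact: (measurable_ge_preimage _ _ mb).
- exact: (measurable_ge_preimage _ _ measurable_fst_snd).
- exact: (measurable_ge_preimage _ _ md).
Qed.

Lemma measurable_simplex {R : realType} : measurable (simplex R).
Proof.
rewrite (_ : simplex R = [set p | 0 <= p.1.1] `&` [set p | 0 <= p.2 - p.1.1] `&`
    ([set p | 0 <= p.1.2] `&` [set p | 0 <= 1 - p.2 - p.1.2])); last first.
  apply/seteqP; split => p /=; first by move=> [? ? ? ?]; split; split; lra.
  by move=> [[? ?] [? ?]]; split; lra.
have [m1 m2 m3 m4] := measurable_weights (0 : R).
by apply: measurableI; exact: measurableI.
Qed.

Lemma measurable_subsimplex {R : realType} c : measurable (subsimplex R c).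
Proof.
rewrite (_ : subsimplex R c = simplex R `&`
    ([set p | ratr c.1.1.1 <= p.1.1] `&` [set p | ratr c.1.1.2 <= p.2 - p.1.1] `&`
    ([set p | ratr c.1.2 <= p.1.2] `&` [set p | ratr c.2 <= 1 - p.2 - p.1.2])));
    last first.
  apply/seteqP; split => p /=; first by move=> [].
  by move=> [? [[? ?] [? ?]]].
apply: measurableI; first exact: measurable_simplex.
have [m1 _ _ _] := measurable_weights (ratr c.1.1.1 : R).
have [_ m2 _ _] := measurable_weights (ratr c.1.1.2 : R).
have [_ _ m3 _] := measurable_weights (ratr c.1.2 : R).
have [_ _ _ m4] := measurable_weights (ratr c.2 : R).
by apply: measurableI; exact: measurableI.
Qed.

(** The bounds are weak because a weight [w] of a boundary point can vanish, and then only [c = 0]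
    fits. *)
Lemma rat_ge0_between {R : realType} (t w : R) : 0 < t -> t <= 1 -> 0 <= w ->
  exists c : rat, (1 - t) * w <= ratr c <= w.
Proof.
move=> t0 t1; rewrite le_eqVlt => /predU1P[<-|w0].
  by exists 0%:Q; rewrite rmorph0 mulr0 lexx.
have [|c] := @rat_in_itvoo R ((1 - t) * w) w; first by nra.
by rewrite in_itv/= => /andP[c1 c2]; exists c; rewrite !ltW.
Qed.

(* A convex function on a simplex is upper semicontinuous: if the barycentric
   weights of [q] are at least [1 - t] times those of [p], then [q] is a convex
   combination [(1 - t) p + t q'] with [q'] in the simplex. *)
Lemma measurable_fun_convex_simplex {R : realType} (h : pt R -> R) :
  convex_on (simplex R) h -> measurable_fun (simplex R) h.
Proof.
move=> hconv mS; apply: (measurability _ (RGenInftyO.measurableE R)) => //.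
move=> _ [_ [r ->] <-].
(* A strict sublevel set is the union of the [subsimplex] sets contained in it. The second factor is
   everything or empty, according to whether [c] is admissible, so that the union can range over all
   [c]. *)
rewrite (_ : _ `&` _ = \bigcup_c (subsimplex R c `&`
    [set _ | subsimplex R c `<=` [set p | h p < r]])); last first.
  apply/seteqP; split => [p [Sp] /=|p [c _ [/= cp]]]; last first.
    by move/(_ _ cp) => /= hr; split; [case: cp|rewrite /= in_itv].
  rewrite in_itv/= => hpr.
  have [M hM] := simplex_convex_bounded h hconv.
  have [t [t0 t1 tr]] : exists t : R, [/\ 0 < t, t <= 1 & (1 - t) * h p + t * M < r].
    have hpM := hM _ Sp.
    (* Chosen so that [e] times [M - h p] is at most half of [r - h p]. The extra [r - h p] in the
       denominator keeps it positive when [M = h p]. *)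
    pose e := (r - h p) / (M - h p + (r - h p)) / 2.
    exists e; have D0 : 0 < M - h p + (r - h p) by lra.
    have eD : e * (M - h p + (r - h p)) * 2 = r - h p.
      by rewrite /e; field; rewrite gt_eqF.
    have e0 : 0 < e by rewrite !divr_gt0//; lra.
    have er : 0 < e * (r - h p) by rewrite mulr_gt0//; lra.
    have eM : 0 <= e * (M - h p) by rewrite mulr_ge0//; lra.
    split => //; last by lra.
    rewrite -(ler_pM2r (_ : 0 < r - h p)); lra.
  case: (Sp) => p1 p2 p3 p4.
  have [c1 /andP[c1l c1u]] := rat_ge0_between t _ t0 t1 p1.
  have [|c2 /andP[c2l c2u]] := rat_ge0_between t (p.2 - p.1.1) t0 t1; first by lra.
  have [c3 /andP[c3l c3u]] := rat_ge0_between t _ t0 t1 p3.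
  have [|c4 /andP[c4l c4u]] := rat_ge0_between t (1 - p.2 - p.1.2) t0 t1; first by lra.
  exists (c1, c2, c3, c4) => //; split => //= q [[q1 q2 q3 q4] /= h1 h2 h3 h4] /=.
  pose q' := pscale t^-1 (padd q (pscale (- (1 - t)) p)).
  have Sq' : simplex R q'.
    rewrite /q' /simplex /=; split.
    - by rewrite mulr_ge0 ?invr_ge0//; lra.
    - by rewrite ler_pM2l ?invr_gt0//; lra.
    - by rewrite mulr_ge0 ?invr_ge0//; lra.
    - by rewrite -(ler_pM2l t0) mulrBr !mulVKf ?gt_eqF//; lra.
  have qE : q = padd (pscale (1 - t) p) (pscale (1 - (1 - t)) q').
    rewrite /q' /padd /pscale /=; case: (q) (p) => -[x y] z [[x' y'] z'] /=.
    by congr (_, _, _); field; rewrite gt_eqF.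
  rewrite [in h q]qE; apply: le_lt_trans (hconv _ _ (1 - t) Sp Sq' _) _.
    by apply/andP; split; lra.
  by have := hM _ Sq'; nra.
apply: countable_bigcupT_measurable => // c.
have [H|H] := pselect (subsimplex R c `<=` [set p | h p < r]).
  rewrite (_ : [set _ | _] = setT); last by apply/seteqP; split.
  by rewrite setIT; exact: measurable_subsimplex.
rewrite (_ : [set _ | _] = set0); last by apply/seteqP; split.
by rewrite setI0.
Qed.

(** * The integral inequality on the model simplex *)

Lemma integral_deriv_horner {R : realType} (p : {poly R}) (a b : R) : a <= b ->
  (\int[lebesgue_measure]_(x in `[a, b]) (p^`().[x])%:E = (p.[b] - p.[a])%:E)%E.
Proof.
rewrite le_eqVlt => /predU1P[->|ab].
  by rewrite set_itv1 integral_set1 subrr.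
rewrite (@continuous_FTC2 _ _ (horner p)) -?EFinB//.
- by apply: continuous_subspaceT => x; exact: continuous_horner.
- split=> [x _||].
  + exact: derivable_horner.
  + by apply: cvg_at_right_filter; exact: continuous_horner.
  + by apply: cvg_at_left_filter; exact: continuous_horner.
- by move=> x _; rewrite -derivE.
Qed.

Lemma integral_horner_primitive {R : realType} (q : {poly R}) (f : R -> R) (a b : R) :
  a <= b -> (forall x, f x = q^`().[x]) ->
  (\int[@lebesgue_measure R]_(x in `[a, b]) (f x)%:E = (q.[b] - q.[a])%:E)%E.
Proof.
by move=> ab fq; under eq_integral do rewrite fq; exact: integral_deriv_horner.
Qed.

(** One factor [s] is the convexity weight, the other comes from the substitution. With the side
    [1 - s] of the slice they form the density [s^2 (1 - s)]. *)
Lemma integral_itv_scale {R : realType} (A : R -> R) (s : R) : 0 <= s ->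
  measurable_fun `[0 : R, 1] A -> (forall t, 0 <= t <= 1 -> 0 <= A t) ->
  (\int[lebesgue_measure]_(t in `[0%R, s]) (s * A (t / s))%:E =
   (s ^+ 2)%:E * \int[lebesgue_measure]_(t in `[0%R, 1%R]) (A t)%:E)%E.
Proof.
rewrite le_eqVlt => /predU1P[<- _ _|s0 mA A0].
  by rewrite set_itv1 integral_set1 expr0n mul0e.
have mphi : measurable_fun [set: measurableTypeR R]
    ((fun t => t / s) : measurableTypeR R -> measurableTypeR R).
  exact: measurable_funM.
have sE : `[0, s]%classic = (fun t => t / s) @^-1` `[0, 1]%classic.
  apply/seteqP; split => t /=; rewrite !in_itv/= ler_pdivlMr// ler_pdivrMr//;
    by rewrite mul0r mul1r.
have equiv B : measurable B ->
    (@lebesgue_measure R ((fun t => t / s)%R @^-1` B) =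
     s%:E * lebesgue_measure B)%E.
  move=> mB; have := lebesgue_measure_affine s^-1 0 B (lt0r_neq0 _) mB.
  rewrite invrK gtr0_norm// invr_gt0 => /(_ s0) <-; congr lebesgue_measure.
  by apply/seteqP; split => t /=; rewrite addr0 mulrC.
rewrite sE (ge0_integral_equivariant (@lebesgue_measure R)
  (fun t => t / s) s `[0, 1]%classic (fun t => (s * A t)%:E) mphi)//; last 3 first.
- exact: ltW.
- by apply/measurable_EFinP; apply: measurable_funM.
- move=> t /=; rewrite in_itv/= => t01.
  by rewrite lee_fin mulr_ge0 ?A0// ltW.
under eq_integral do rewrite EFinM.
rewrite ge0_integralZl//.
- by rewrite muleA expr2 EFinM.
- exact/measurable_EFinP.
- by rewrite lee_fin ltW.
Qed.

Lemma ge0_integral_leb2_mul {R : realType} (u v : R -> \bar R) :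
  measurable_fun setT u -> measurable_fun setT v ->
  (forall x, 0 <= u x)%E -> (forall x, 0 <= v x)%E ->
  (\int[@leb2 R]_x (u x.1 * v x.2) =
   \int[lebesgue_measure]_x u x * \int[lebesgue_measure]_x v x)%E.
Proof.
move=> mu mv u0 v0.
rewrite (fubini_tonelli1 (m1 := @lebesgue_measure R) (m2 := @lebesgue_measure R)
  (fun x => u x.1 * v x.2)%E); last 2 first.
- apply: emeasurable_funM.
    exact: (measurableT_comp mu measurable_fst).
  exact: (measurableT_comp mv measurable_snd).
- by move=> x; exact: mule_ge0.
have Iv0 : (0 <= \int[lebesgue_measure]_x v x)%E by exact: integral_ge0.
rewrite [RHS]muleC -ge0_integralZl//.
by apply: eq_integral => x _; rewrite /fubini_F /= ge0_integralZl// muleC.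
Qed.

Lemma ge0_integral_leb2_rect {R : realType} (u v : R -> R) (D E : set R) :
  measurable D -> measurable E -> measurable_fun D u -> measurable_fun E v ->
  (forall x, D x -> 0 <= u x) -> (forall x, E x -> 0 <= v x) ->
  [/\ measurable_fun setT (fun x : R * R => ((EFin \o u) \_ D) x.1 * ((EFin \o v) \_ E) x.2)%E,
    (forall x : R * R, 0 <= ((EFin \o u) \_ D) x.1 * ((EFin \o v) \_ E) x.2)%E &
  (\int[@leb2 R]_x (((EFin \o u) \_ D) x.1 * ((EFin \o v) \_ E) x.2) =
   \int[lebesgue_measure]_(x in D) (u x)%:E *
   \int[lebesgue_measure]_(x in E) (v x)%:E)%E].
Proof.
move=> mD mE mu mv u0 v0.
have mu' : measurable_fun setT ((EFin \o u) \_ D).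
  exact/(measurable_restrictT _ mD)/measurable_EFinP.
have mv' : measurable_fun setT ((EFin \o v) \_ E).
  exact/(measurable_restrictT _ mE)/measurable_EFinP.
have u'0 x : (0 <= ((EFin \o u) \_ D) x)%E.
  by apply: erestrict_ge0 => y Dy; rewrite lee_fin u0.
have v'0 x : (0 <= ((EFin \o v) \_ E) x)%E.
  by apply: erestrict_ge0 => y Ey; rewrite lee_fin v0.
split.
- apply: emeasurable_funM.
    exact: (measurableT_comp mu' measurable_fst).
  exact: (measurableT_comp mv' measurable_snd).
- by move=> x; exact: mule_ge0.
- by rewrite ge0_integral_leb2_mul// -!integral_mkcond.
Qed.

Lemma integral_itv_cst1 {R : realType} (s : R) : 0 <= s ->
  (\int[@lebesgue_measure R]_(x in `[0%R, s]) 1%:E = s%:E)%E.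
Proof.
move=> s0; rewrite integral_cst//= mul1e lebesgue_measure_itv/= lte_fin.
by case: ltP => [|s0']; rewrite ?sube0//; congr EFin; lra.
Qed.

Lemma measurable_fun_scaled {R : realType} (A : R -> R) (s : R) : 0 <= s ->
  measurable_fun `[0 : R, 1] A ->
  measurable_fun `[0 : R, s] (fun a => s * A (a / s)).
Proof.
move=> s0 mA; apply: measurable_funM => //.
apply: (measurable_comp (F := `[0 : R, 1]%classic)) mA _ => //; last first.
  exact: measurable_funM.
move=> _ [a /= + <-]; rewrite !in_itv/= => /andP[a0 a_s].
rewrite divr_ge0//=; have [->|s_neq0] := eqVneq s 0; first by rewrite invr0 mulr0.
by rewrite ler_pdivrMr ?mul1r// lt_neqAle eq_sym s_neq0.
Qed.

(** By [simplex_convex_le] the slice at height [s] contributes at most [H s], whose two densities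
    [s^2 (1 - s)] and [s (1 - s)^2] both integrate to 1/12. This is half of the volume 1/6, hence
    the equal weights of the two edges. *)
Lemma integral_simplex_le {R : realType} (h : pt R -> R) :
  convex_on (simplex R) h -> (forall p, simplex R p -> 0 <= h p) ->
  (\int[@leb3 R]_(p in simplex R) (h p)%:E <= (12^-1)%:E *
    (\int[lebesgue_measure]_(t in `[0%R, 1%R]) (h (t, 0, 1))%:E +
     \int[lebesgue_measure]_(t in `[0%R, 1%R]) (h (0, t, 0))%:E))%E.
Proof.
move=> hconv h0.
have mh : measurable_fun (simplex R) h by exact: measurable_fun_convex_simplex.
have mS : measurable (simplex R) by exact: measurable_simplex.
pose A t := h (t, 0, 1); pose B t := h (0, t, 0).
have mA : measurable_fun `[0 : R, 1] A.
  apply: (measurable_comp (F := simplex R)) mh _ => //.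
    by move=> _ [t /= + <-]; rewrite in_itv/= => /andP[? ?]; split => /=; lra.
  apply: measurable_funTS; apply: measurable_pt_fun => /=;
    [exact: measurable_id|exact: measurable_cst|exact: measurable_cst].
have mB : measurable_fun `[0 : R, 1] B.
  apply: (measurable_comp (F := simplex R)) mh _ => //.
    by move=> _ [t /= + <-]; rewrite in_itv/= => /andP[? ?]; split => /=; lra.
  apply: measurable_funTS; apply: measurable_pt_fun => /=;
    [exact: measurable_cst|exact: measurable_id|exact: measurable_cst].
have A0 t : 0 <= t <= 1 -> 0 <= A t.
  by move=> /andP[? ?]; apply: h0; split => /=; lra.
have B0 t : 0 <= t <= 1 -> 0 <= B t.
  by move=> /andP[? ?]; apply: h0; split => /=; lra.
set IA := (\int[lebesgue_measure]_(t in _) (h (t, 0, 1))%:E)%E.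
set IB := (\int[lebesgue_measure]_(t in _) (h (0, t, 0))%:E)%E.
have IA0 : (0 <= IA)%E.
  by apply: integral_ge0 => t /=; rewrite in_itv/= lee_fin; exact: A0.
have IB0 : (0 <= IB)%E.
  by apply: integral_ge0 => t /=; rewrite in_itv/= lee_fin; exact: B0.
pose F := ((EFin \o h) \_ (simplex R) : pt R -> \bar R).
have mF : measurable_fun setT F.
  exact/(measurable_restrictT _ mS)/measurable_EFinP.
have F0 x : (0 <= F x)%E.
  by apply: erestrict_ge0 => y Sy; rewrite lee_fin h0.
pose H (s : R) := (IA * (s ^+ 2 * (1 - s))%:E + IB * (s * (1 - s) ^+ 2)%:E)%E.
have slice (s : R) : 0 <= s <= 1 -> (\int[@leb2 R]_x F (x, s) <= H s)%E.
  move=> /andP[s0 s1]; have s'0 : 0 <= 1 - s by lra.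
  have sA0 a : `[0, s]%classic a -> 0 <= s * A (a / s).
    rewrite /= in_itv/= => /andP[a0 a_s]; rewrite mulr_ge0// A0// divr_ge0//=.
    have [->|s_neq0] := eqVneq s 0; first by rewrite invr0 mulr0.
    by rewrite ler_pdivrMr ?mul1r// lt_neqAle eq_sym s_neq0.
  have sB0 a : `[0, 1 - s]%classic a -> 0 <= (1 - s) * B (a / (1 - s)).
    rewrite /= in_itv/= => /andP[a0 a_s]; rewrite mulr_ge0// B0// divr_ge0//=.
    have [->|s_neq0] := eqVneq (1 - s) 0; first by rewrite invr0 mulr0.
    by rewrite ler_pdivrMr ?mul1r// lt_neqAle eq_sym s_neq0.
  have [m1 n1 E1] := ge0_integral_leb2_rect (fun a => s * A (a / s)) (fun=> 1)
    `[0, s]%classic `[0, 1 - s]%classic (measurable_itv _) (measurable_itv _)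
    (measurable_fun_scaled A s s0 mA) (measurable_cst _) sA0 (fun _ _ => ler01).
  have [m2 n2 E2] := ge0_integral_leb2_rect (fun=> 1)
    (fun a => (1 - s) * B (a / (1 - s)))
    `[0, s]%classic `[0, 1 - s]%classic (measurable_itv _) (measurable_itv _)
    (measurable_cst _) (measurable_fun_scaled B (1 - s) s'0 mB) (fun _ _ => ler01) sB0.
  set U1 := (fun x : R * R => _ x.1 * _ x.2)%E in m1 n1.
  set U2 := (fun x : R * R => _ x.1 * _ x.2)%E in m2 n2.
  (* On the slice, [U1 + U2] is the right-hand side of [simplex_convex_le]; in each summand only one
     coordinate matters, so its integral factors. *)
  have -> : H s = (\int[@leb2 R]_x (U1 x + U2 x))%E.
    rewrite ge0_integralD//; last 2 first.
    - by move=> x _; exact: n1.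
    - by move=> x _; exact: n2.
    transitivity ((\int[@leb2 R]_x U1 x) + (\int[@leb2 R]_x U2 x))%E => //.
    rewrite E1 E2 !integral_itv_scale// !integral_itv_cst1// /H.
    rewrite -/IA -/IB; congr (_ + _)%E; last by rewrite EFinM muleC muleA.
    by rewrite EFinM muleA (muleC IA).
  apply: (ge0_le_integral (@leb2 R) measurableT (f1 := fun x => F (x, s))
    (f2 := fun x => U1 x + U2 x)%E) => //.
  - exact: (measurable_fun_pair1 s mF).
  - exact: emeasurable_funD.
  - move=> [a g] _; rewrite /F patchE; case: ifPn => [|_]; last first.
      by apply: adde_ge0; [exact: n1|exact: n2].
    rewrite inE => Sx; case: (Sx) => /= a0 a_s g0 gs.
    rewrite /U1 /U2 /= !patchE !mem_set /= ?in_itv/= ?a0 ?a_s ?g0 ?gs//.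
    by rewrite mule1 mul1e -EFinD lee_fin (simplex_convex_le h (a, g, s)).
have slice0 (s : R) : ~~ (0 <= s <= 1) -> (\int[@leb2 R]_x F (x, s) = 0)%E.
  move=> s01; apply: integral0_eq => -[a g] _; rewrite /F patchE memNset//.
  by case=> /= a0 a_s g0 gs; move/negP: s01; apply; apply/andP; split; lra.
rewrite integral_mkcond -/F.
rewrite (fubini_tonelli2 (m1 := @leb2 R) (m2 := @lebesgue_measure R) F)//.
have J1 : (\int[@lebesgue_measure R]_(s in `[0%R, 1%R]) (s ^+ 2 * (1 - s))%:E =
    (12^-1)%:E)%E.
  rewrite (integral_horner_primitive (3^-1 *: 'X^3 - 4^-1 *: 'X^4)) ?ler01//.
    by rewrite !hornerE /=; congr EFin; field.
  by move=> x; rewrite !poly.derivE !hornerE /=; field.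
have J2 : (\int[@lebesgue_measure R]_(s in `[0%R, 1%R]) (s * (1 - s) ^+ 2)%:E =
    (12^-1)%:E)%E.
  rewrite (integral_horner_primitive
    (2^-1 *: 'X^2 - (2 / 3) *: 'X^3 + 4^-1 *: 'X^4)) ?ler01//.
    by rewrite !hornerE /=; congr EFin; field.
  by move=> x; rewrite !poly.derivE !hornerE /=; field.
have w1 : measurable_fun [set: R] (fun s : R => (s ^+ 2 * (1 - s))%:E).
  apply/measurable_EFinP.
  by apply: measurable_funM; [exact: measurable_funX|exact: measurable_funB].
have w2 : measurable_fun [set: R] (fun s : R => (s * (1 - s) ^+ 2)%:E).
  apply/measurable_EFinP.
  by apply: measurable_funM => //; apply: measurable_funX; exact: measurable_funB.
have w1' := measurable_funTS (D := `[0 : R, 1]%classic) w1.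
have w2' := measurable_funTS (D := `[0 : R, 1]%classic) w2.
have v1 (s : R) : `[0 : R, 1]%classic s -> (0 <= (s ^+ 2 * (1 - s))%:E)%E.
  by rewrite /= in_itv/= lee_fin => /andP[? ?]; rewrite mulr_ge0 ?exprn_ge0//; lra.
have v2 (s : R) : `[0 : R, 1]%classic s -> (0 <= (s * (1 - s) ^+ 2)%:E)%E.
  by rewrite /= in_itv/= lee_fin => /andP[? ?]; rewrite mulr_ge0 ?exprn_ge0//; lra.
have k1 : measurable_fun `[0 : R, 1] (fun s => IA * (s ^+ 2 * (1 - s))%:E)%E.
  by apply: emeasurable_funM.
have k2 : measurable_fun `[0 : R, 1] (fun s => IB * (s * (1 - s) ^+ 2)%:E)%E.
  by apply: emeasurable_funM.
have le_slices : (\int[lebesgue_measure]_s fubini_G (@leb2 R) F s <=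
    \int[lebesgue_measure]_(s in `[0%R, 1%R]) H s)%E.
  rewrite [leRHS]integral_mkcond.
  apply: (ge0_le_integral (@lebesgue_measure R) measurableT
    (f1 := fubini_G (@leb2 R) F) (f2 := H \_ `[0 : R, 1]%classic)) => //.
  - by move=> s _; apply: integral_ge0 => x _; exact: F0.
  - exact: (measurable_fun_fubini_tonelli_G (m1 := @leb2 R) F mF F0).
  - apply/(measurable_restrictT _ (measurable_itv _)).
    exact: emeasurable_funD.
  - move=> s _; rewrite /fubini_G patchE; case: ifPn; rewrite mem_setE in_itv/=.
      exact: slice.
    by move=> /slice0 ->.
apply: (le_trans le_slices); rewrite /H ge0_integralD//; last 2 first.
- by move=> s /v1 ?; exact: mule_ge0.
- by move=> s /v2 ?; exact: mule_ge0.
rewrite !ge0_integralZl// J1 J2 ge0_muleDr//.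
by rewrite (muleC IA) (muleC IB).
Qed.

(** Slices have area [s (1 - s)]. Together with the volume of [std_tetra] this value determines the
    scaling factor of [of_simplex]. *)
Lemma leb3_simplex {R : realType} : leb3 (simplex R) = (6^-1)%:E.
Proof.
rewrite [LHS](product_measure1_ysection (@leb2 R) (@lebesgue_measure R) (simplex R)
  measurable_simplex).
transitivity (\int[lebesgue_measure]_(s in `[0%R, 1%R]) (s * (1 - s) : R)%:E)%E.
  rewrite [RHS]integral_mkcond; apply: eq_integral => s _.
  rewrite patchE; case: ifPn; rewrite mem_setE in_itv/= => s01.
    have -> : [set x | simplex R (x, s)] = `[0, s]%classic `*` `[0, 1 - s]%classic.
      apply/seteqP; split => -[a g]; rewrite /simplex /= !in_itv/=.
        by move=> [-> -> -> ->].
      by move=> [/andP[-> ->] /andP[-> ->]].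
    rewrite [LHS](product_measure1E (@lebesgue_measure R) (@lebesgue_measure R)
      (measurable_itv _) (measurable_itv _)).
    have len (r : R) : 0 <= r -> lebesgue_measure `[0, r]%classic = r%:E.
      move=> r0; rewrite lebesgue_measure_itv/= lte_fin.
      by case: ltP => [|r0']; rewrite ?sube0//; congr EFin; lra.
    have /andP[s0 s1] := s01.
    by rewrite EFinM; congr (_ * _)%E; apply: len; lra.
  rewrite (_ : [set x | simplex R (x, s)] = set0) ?measure0//.
  apply/seteqP; split => // -[a g] [/= a0 a_s g0 gs].
  by move/negP: s01; apply; apply/andP; split; lra.
rewrite (integral_horner_primitive (2^-1 *: 'X^2 - 3^-1 *: 'X^3)) ?ler01//.
  by rewrite !hornerE /=; congr EFin; field.
by move=> x; rewrite !poly.derivE !hornerE /=; field.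
Qed.

(** * One of the twelve tetrahedra, in cube coordinates *)

(** Half of the pyramid over the face where the first coordinate is 1, cut off by the plane through
    [O], [(1, 1, 1)] and [(1, -1, -1)]. Here [(1, 1, 1)] plays the role of [V]. *)
Definition std_tetra (R : realType) : set (pt R) :=
  [set p | [/\ - p.1.1 <= p.1.2, p.1.2 <= p.2, p.2 <= p.1.1 & p.1.1 <= 1]].

Lemma measurable_std_tetra {R : realType} : measurable (std_tetra R).
Proof.
have mx := @measurable_fst_fst R; have my := @measurable_fst_snd R.
have mz : measurable_fun setT (fun p : pt R => p.2) := measurable_snd.
rewrite (_ : std_tetra R = [set p | 0 <= p.1.1 + p.1.2] `&` [set p | 0 <= p.2 - p.1.2]
    `&` ([set p | 0 <= p.1.1 - p.2] `&` [set p | 0 <= 1 - p.1.1])); last first.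
  apply/seteqP; split => p /=; first by move=> [? ? ? ?]; split; split; lra.
  by move=> [[? ?] [? ?]]; split; lra.
apply: measurableI; apply: measurableI.
- exact: (measurable_ge_preimage _ _ (measurable_funD mx my)).
- exact: (measurable_ge_preimage _ _ (measurable_funB mz my)).
- exact: (measurable_ge_preimage _ _ (measurable_funB mx mz)).
- exact: (measurable_ge_preimage _ _ (measurable_funB (measurable_cst _) mx)).
Qed.

(** Sections in the last coordinate have length [x - y], which integrates to [2 x^2] over [y]
    between [- x] and [x]. The result is a twelfth of the volume 8 of the coordinate cube. *)
Lemma leb3_std_tetra {R : realType} : leb3 (std_tetra R) = (2 / 3)%:E.
Proof.
pose G (q : R * R) := lebesgue_measure (xsection (std_tetra R) q).
have mG : measurable_fun setT G.
  exact: (measurable_fun_xsection (@lebesgue_measure R) measurable_std_tetra).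
have GE x y : G (x, y) =
    if (- x <= y <= x) && (x <= 1) then (x - y)%:E else 0%E.
  rewrite /G; have -> : xsection (std_tetra R) (x, y) =
      [set z | std_tetra R (x, y, z)].
    by apply/seteqP; split => z; rewrite /xsection /= in_setE.
  case: ifPn => [/andP[/andP[y1 y2] x1]|nxy].
    have -> : [set z | std_tetra R (x, y, z)] = `[y, x]%classic.
      apply/seteqP; split => z; rewrite /std_tetra /= in_itv/=.
        by move=> [_ -> ->].
      by move=> /andP[-> ->].
    rewrite lebesgue_measure_itv/= lte_fin.
    by case: ltP => [|xy]; rewrite -?EFinB//; congr EFin; lra.
  rewrite (_ : [set z | std_tetra R (x, y, z)] = set0) ?measure0//.
  apply/seteqP; split => // z [/= h1 h2 h3 h4].
  by move/negP: nxy; apply; rewrite h1 h4 (le_trans h2 h3).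
have -> : leb3 (std_tetra R) = (\int[@leb2 R]_q G q)%E by [].
rewrite (fubini_tonelli1 (m1 := @lebesgue_measure R) (m2 := @lebesgue_measure R) G)//.
transitivity (\int[lebesgue_measure]_(x in `[0%R, 1%R]) (2 * x ^+ 2 : R)%:E)%E.
  rewrite [RHS]integral_mkcond; apply: eq_integral => x _.
  rewrite /fubini_F patchE; case: ifPn; rewrite mem_setE in_itv/=.
    move=> /andP[x0 x1].
    transitivity (\int[lebesgue_measure]_(y in `[(- x)%R, x]) (x - y)%:E)%E.
      rewrite [RHS]integral_mkcond; apply: eq_integral => y _.
      by rewrite GE x1 andbT patchE mem_setE in_itv.
    rewrite (integral_horner_primitive (x *: 'X - 2^-1 *: 'X^2)); last 2 first.
    - lra.
    - by move=> y; rewrite !poly.derivE !hornerE /=; field.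
    by rewrite !hornerE /=; congr EFin; field.
  move=> x01; apply: integral0_eq => y _; rewrite GE.
  case: ifPn => // /andP[/andP[h1 h2] h3].
  by move/negP: x01; case; apply/andP; split; lra.
rewrite (integral_horner_primitive ((2 / 3) *: 'X^3)) ?ler01//.
  by rewrite !hornerE /=; congr EFin; field.
by move=> x; rewrite !poly.derivE !hornerE /=; field.
Qed.

Lemma measurable_fun_convex_affine {R : realType} (D : set (pt R))
    (phi psi : pt R -> pt R) (g : pt R -> R) :
  measurable D -> measurable_fun setT psi -> cancel psi phi ->
  psi @` D `<=` simplex R -> convex_on (simplex R) (g \o phi) ->
  measurable_fun D g.
Proof.
move=> mD mpsi psiK Dsub gconv.
have -> : g = (g \o phi) \o psi by apply/funext => x /=; rewrite psiK.
apply: (measurable_comp (F := simplex R)) (measurable_fun_convex_simplex _ gconv) _ => //.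
  exact: measurable_simplex.
exact: measurable_funTS.
Qed.

(* [((al, ga), s)] are coordinates on [std_tetra] in which the barycentric
   weights of its vertices [(1,1,1)], [(1,-1,1)], [(1,-1,-1)] and [(0,0,0)] are
   [s - al], [al], [ga] and [1 - s - ga]. *)
Definition of_simplex {R : realType} (q : pt R) : pt R :=
  (q.2 + q.1.2, q.2 - q.1.2 - 2 * q.1.1, q.2 - q.1.2).

Definition to_simplex {R : realType} (p : pt R) : pt R :=
  ((p.2 - p.1.2) / 2, (p.1.1 - p.2) / 2, (p.1.1 + p.2) / 2).

Lemma of_simplexK {R : realType} : cancel (@of_simplex R) to_simplex.
Proof.
by move=> [[a g] s]; rewrite /of_simplex /to_simplex /=; congr (_, _, _); field.
Qed.

Lemma to_simplexK {R : realType} : cancel (@to_simplex R) of_simplex.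
Proof.
by move=> [[x y] z]; rewrite /of_simplex /to_simplex /=; congr (_, _, _); field.
Qed.

Lemma of_simplexD {R : realType} (x y : pt R) :
  of_simplex (padd x y) = padd (of_simplex x) (of_simplex y).
Proof. by rewrite /of_simplex /padd /=; congr (_, _, _); ring. Qed.

Lemma to_simplexD {R : realType} (x y : pt R) :
  to_simplex (padd x y) = padd (to_simplex x) (to_simplex y).
Proof. by rewrite /to_simplex /padd /=; congr (_, _, _); field. Qed.

Lemma of_simplexZ {R : realType} (t : R) (x : pt R) :
  of_simplex (pscale t x) = pscale t (of_simplex x).
Proof. by rewrite /of_simplex /pscale /=; congr (_, _, _); ring. Qed.

Lemma measurable_of_simplex {R : realType} : measurable_fun setT (@of_simplex R).
Proof.
have mx := @measurable_fst_fst R; have my := @measurable_fst_snd R.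
have mz : measurable_fun setT (fun p : pt R => p.2) := measurable_snd.
apply: measurable_pt_fun => /=.
- exact: measurable_funD.
- apply: measurable_funB; first exact: measurable_funB.
  exact: measurable_funM.
- exact: measurable_funB.
Qed.

Lemma measurable_to_simplex {R : realType} : measurable_fun setT (@to_simplex R).
Proof.
have mx := @measurable_fst_fst R; have my := @measurable_fst_snd R.
have mz : measurable_fun setT (fun p : pt R => p.2) := measurable_snd.
apply: measurable_pt_fun => /=; apply: measurable_funM => //.
- exact: measurable_funB.
- exact: measurable_funB.
- exact: measurable_funD.
Qed.

Lemma of_simplex_preimage {R : realType} : of_simplex @^-1` std_tetra R = simplex R.
Proof.
apply/seteqP; split => -[[a g] s]; rewrite /std_tetra /simplex /of_simplex /=;
  by move=> [? ? ? ?]; split; lra.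
Qed.

Lemma convex_of_simplex {R : realType} (g : pt R -> R) :
  convex_on (std_tetra R) g -> convex_on (simplex R) (g \o of_simplex).
Proof.
rewrite -of_simplex_preimage => gconv x y t Sx Sy t01 /=.
by rewrite of_simplexD !of_simplexZ; exact: gconv.
Qed.

Lemma measurable_fun_std_tetra {R : realType} (g : pt R -> R) :
  convex_on (std_tetra R) g -> measurable_fun (std_tetra R) g.
Proof.
move=> gconv; apply: (measurable_fun_convex_affine (std_tetra R) of_simplex
  to_simplex) => //.
- exact: measurable_std_tetra.
- exact: measurable_to_simplex.
- exact: to_simplexK.
- by rewrite -of_simplex_preimage => _ [x Tx <-] /=; rewrite to_simplexK.
- exact: convex_of_simplex.
Qed.

(** [of_simplex] carries the opposite edges of the simplex to an edge at [(1, 1, 1)] and to the half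
    diagonal ending at [(1, -1, -1)]. The factor 1/3 is half of the volume 2/3. *)
Lemma std_tetra_integral_le {R : realType} (g : pt R -> R) :
  convex_on (std_tetra R) g -> (forall p, std_tetra R p -> 0 <= g p) ->
  (\int[@leb3 R]_(p in std_tetra R) (g p)%:E <= (3^-1)%:E *
    (\int[lebesgue_measure]_(t in `[0%R, 1%R]) (g (1, 1 - 2 * t, 1))%:E +
     \int[lebesgue_measure]_(t in `[0%R, 1%R]) (g (t, - t, - t))%:E))%E.
Proof.
move=> gconv g0.
have [k k0 kE] : exists2 k : R, 0 < k &
    forall A, measurable A -> leb3 (of_simplex @^-1` A) = (k%:E * leb3 A)%E.
  apply: (leb3_scaling of_simplex to_simplex to_simplex of_simplex).
  - exact: measurable_of_simplex.
  - exact: measurable_to_simplex.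
  - exact: of_simplexK.
  - by move=> x y; rewrite of_simplexD to_simplexK.
  - by move=> x y; rewrite to_simplexD of_simplexK.
(* Uniqueness leaves [k] unspecified; the volumes 1/6 and 2/3 of a set and its preimage fix it. *)
have k4 : k = 4^-1.
  have := kE _ measurable_std_tetra; rewrite of_simplex_preimage.
  by rewrite leb3_simplex leb3_std_tetra -EFinM => -[kE'']; lra.
have := integral_simplex_le _ (convex_of_simplex g gconv).
rewrite -of_simplex_preimage => /(_ (fun p => g0 _)).
have mg : measurable_fun (std_tetra R) (fun p => (g p)%:E).
  by apply/measurable_EFinP; exact: measurable_fun_std_tetra.
rewrite (ge0_integral_equivariant (@leb3 R) of_simplex k (std_tetra R)
  (fun p => (g p)%:E) measurable_of_simplex (ltW k0) kE measurable_std_tetra mg g0).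
set I := (\int[@leb3 R]_(p in std_tetra R) (g p)%:E)%E.
set J := (_ + _)%E; set J' := (_ + _)%E => le_kI.
have -> : J' = J.
  rewrite /J' /J /of_simplex /=; congr (_ + _)%E; apply: eq_integral => t _;
  by congr (g (_, _, _))%:E; ring.
have -> : I = (4%:E * (k%:E * I))%E.
  by rewrite muleA -EFinM k4 mulfV ?mul1e.
apply: le_trans (lee_wpmul2l _ le_kI) _; first by rewrite lee_fin.
rewrite muleA -EFinM (_ : 4 * 12^-1 = 3^-1)//; by field.
Qed.

(** * Coordinates adapted to a cube *)

Definition frame_map {R : realType} (c u v w x : pt R) : pt R :=
  cpt c u v w x.1.1 x.1.2 x.2.

Definition coords {R : realType} (c u v w p : pt R) : pt R :=
  (pdot (psub p c) u / pdot u u, pdot (psub p c) v / pdot v v,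
   pdot (psub p c) w / pdot w w).

(** Defined by a preimage under [coords] instead of an image under [frame_map], so that
    measurability is immediate. *)
Definition tetra {R : realType} (c u v w : pt R) : set (pt R) :=
  coords c u v w @^-1` std_tetra R.

Section frame.
Context {R : realType}.
Implicit Types c u v w x y p : pt R.

Lemma pdot_frame_map c u v w x p :
  pdot (psub (frame_map c u v w x) c) p =
  x.1.1 * pdot u p + x.1.2 * pdot v p + x.2 * pdot w p.
Proof. by rewrite /pdot /psub /frame_map /cpt /padd /pscale /=; ring. Qed.

Lemma frame_mapK c u v w : is_cube_frame c u v w ->
  cancel (frame_map c u v w) (coords c u v w).
Proof.
move=> [a [a0 [uu [vv [ww [uv [uw vw]]]]]]] [[x y] z].
have dotC p q : pdot p q = pdot q p by rewrite /pdot; ring.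
have a_neq0 : a != 0 by rewrite gt_eqF.
have an0 : a ^+ 2 != 0 by rewrite expf_neq0.
rewrite /coords !pdot_frame_map /= (dotC v u) (dotC w u) (dotC w v).
by rewrite uu vv ww uv uw vw; congr (_, _, _); field.
Qed.

(* The Gram determinant shows that the frame has a nonzero determinant, and
   Cramer's rule recovers a vector from its scalar products with the frame. *)
Lemma coordsK c u v w : is_cube_frame c u v w ->
  cancel (coords c u v w) (frame_map c u v w).
Proof.
move=> [a [a0 [uu [vv [ww [uv [uw vw]]]]]]] p.
have a_neq0 : a != 0 by rewrite gt_eqF.
have an0 : a ^+ 2 != 0 by rewrite expf_neq0.
pose det := u.1.1 * (v.1.2 * w.2 - v.2 * w.1.2) -
  u.1.2 * (v.1.1 * w.2 - v.2 * w.1.1) + u.2 * (v.1.1 * w.1.2 - v.1.2 * w.1.1).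
have gram : det ^+ 2 = pdot u u * pdot v v * pdot w w
    + 2 * pdot u v * pdot u w * pdot v w - pdot u u * pdot v w ^+ 2
    - pdot v v * pdot u w ^+ 2 - pdot w w * pdot u v ^+ 2.
  by rewrite /det /pdot; ring.
have det0 : det != 0.
  apply/negP => /eqP d0; move: gram; rewrite d0 uu vv ww uv uw vw => gram.
  have : 0 < (a ^+ 2) * (a ^+ 2) * (a ^+ 2) by rewrite !mulr_gt0.
  by lra.
have cramer1 q : det * q.1.1 = pdot q u * (v.1.2 * w.2 - v.2 * w.1.2)
    + pdot q v * (w.1.2 * u.2 - w.2 * u.1.2) + pdot q w * (u.1.2 * v.2 - u.2 * v.1.2).
  by rewrite /det /pdot; ring.
have cramer2 q : det * q.1.2 = pdot q u * (v.2 * w.1.1 - v.1.1 * w.2)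
    + pdot q v * (w.2 * u.1.1 - w.1.1 * u.2) + pdot q w * (u.2 * v.1.1 - u.1.1 * v.2).
  by rewrite /det /pdot; ring.
have cramer3 q : det * q.2 = pdot q u * (v.1.1 * w.1.2 - v.1.2 * w.1.1)
    + pdot q v * (w.1.1 * u.1.2 - w.1.2 * u.1.1) + pdot q w * (u.1.1 * v.1.2 - u.1.2 * v.1.1).
  by rewrite /det /pdot; ring.
pose q := psub p c; pose r := psub q (frame_map (0, 0, 0) u v w (coords c u v w p)).
have dotC p' q' : pdot p' q' = pdot q' p' by rewrite /pdot; ring.
have rdot e : pdot r e = pdot q e - (pdot q u / pdot u u * pdot u e
    + pdot q v / pdot v v * pdot v e + pdot q w / pdot w w * pdot w e).
  rewrite /r /coords -/q; move: (pdot q u / _) (pdot q v / _) (pdot q w / _).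
  by move=> x y z; rewrite /pdot /psub /frame_map /cpt /padd /pscale /=; ring.
have ru : pdot r u = 0.
  by rewrite rdot (dotC v u) (dotC w u) uu vv ww uv uw; field.
have rv : pdot r v = 0.
  by rewrite rdot (dotC w v) uu vv ww uv vw; field.
have rw : pdot r w = 0.
  by rewrite rdot uu vv ww uw vw; field.
have zero (t : R) : det * t = 0 -> t = 0.
  by move/eqP; rewrite mulf_eq0 (negbTE det0) => /eqP.
have r1 : r.1.1 = 0 by apply: zero; rewrite cramer1 ru rv rw; ring.
have r2 : r.1.2 = 0 by apply: zero; rewrite cramer2 ru rv rw; ring.
have r3 : r.2 = 0 by apply: zero; rewrite cramer3 ru rv rw; ring.
move: r1 r2 r3; rewrite /r /q {rdot ru rv rw r q}.
move: (coords c u v w p) => x; case: p => -[p1 p2] p3.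
rewrite /psub /frame_map /cpt /padd /pscale /= => r1 r2 r3.
by congr (_, _, _); lra.
Qed.

Lemma is_cube_frame_center c c' u v w :
  is_cube_frame c u v w -> is_cube_frame c' u v w.
Proof. by []. Qed.

Lemma frame_mapD c u v w x y :
  frame_map c u v w (padd x y) =
  padd (frame_map c u v w x) (frame_map (0, 0, 0) u v w y).
Proof. by rewrite /frame_map /cpt /padd /pscale /=; congr (_, _, _); ring. Qed.

Lemma coordsD c u v w x y :
  coords c u v w (padd x y) = padd (coords c u v w x) (coords (0, 0, 0) u v w y).
Proof.
rewrite /coords {1}/padd /=; congr (_, _, _); rewrite -mulrDl; congr (_ / _);
  by rewrite /pdot /psub /padd /pscale /=; ring.
Qed.

Lemma frame_map_convex c u v w x y (t : R) :
  frame_map c u v w (padd (pscale t x) (pscale (1 - t) y)) =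
  padd (pscale t (frame_map c u v w x)) (pscale (1 - t) (frame_map c u v w y)).
Proof. by rewrite /frame_map /cpt /padd /pscale /=; congr (_, _, _); ring. Qed.

Lemma measurable_frame_map c u v w : measurable_fun setT (frame_map c u v w).
Proof.
have mx := @measurable_fst_fst R; have my := @measurable_fst_snd R.
have mz : measurable_fun setT (fun p : pt R => p.2) := measurable_snd.
rewrite /frame_map /cpt; apply: measurable_padd; first exact: measurable_cst.
apply: measurable_padd; first by apply: measurable_pscale.
by apply: measurable_padd; apply: measurable_pscale.
Qed.

Lemma measurable_coords c u v w : measurable_fun setT (coords c u v w).
Proof.
have mx := @measurable_fst_fst R; have my := @measurable_fst_snd R.
have mz : measurable_fun setT (fun p : pt R => p.2) := measurable_snd.
have mdot (e : pt R) : measurable_fun setT (fun p => pdot (psub p c) e).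
  apply: measurable_funD; [apply: measurable_funD|]; apply: measurable_funM => //;
    exact: measurable_funD.
by apply: measurable_pt_fun => /=; apply: measurable_funM.
Qed.

(** The maps with center [(0, 0, 0)] are the linear parts. The value of [k] is never computed: it
    cancels between the volume of the cube and the integrals over the tetrahedra. *)
Lemma leb3_frame_map c u v w : is_cube_frame c u v w ->
  exists2 k : R, 0 < k & forall A, measurable A ->
    leb3 (frame_map c u v w @^-1` A) = (k%:E * leb3 A)%E.
Proof.
move=> frm; have frm0 := is_cube_frame_center _ (0, 0, 0) _ _ _ frm.
apply: (leb3_scaling _ (coords c u v w) (coords (0, 0, 0) u v w)
  (frame_map (0, 0, 0) u v w)).
- exact: measurable_frame_map.
- exact: measurable_coords.
- exact: frame_mapK.
- by move=> x y; rewrite frame_mapD coordsK.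
- by move=> x y; rewrite coordsD frame_mapK.
Qed.

Lemma cubeE c u v w : is_cube_frame c u v w ->
  cube c u v w = coords c u v w @^-1`
    [set x | [/\ x.1.1 \in `[-1, 1], x.1.2 \in `[-1, 1] & x.2 \in `[-1, 1]]].
Proof.
pose box := [set x : pt R |
  [/\ x.1.1 \in `[-1, 1], x.1.2 \in `[-1, 1] & x.2 \in `[-1, 1]]].
move=> frm; apply/seteqP; split => p.
  move=> [x [y [z [xI yI zI ->]]]].
  suff : box (coords c u v w (frame_map c u v w (x, y, z))) by [].
  by rewrite frame_mapK// /box /= !in_itv.
move=> [] /=; rewrite !in_itv/= => xI yI zI.
exists (coords c u v w p).1.1, (coords c u v w p).1.2, (coords c u v w p).2.
by split => //; exact: esym (coordsK _ _ _ _ frm p).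
Qed.

Lemma measurable_cube c u v w : is_cube_frame c u v w -> measurable (cube c u v w).
Proof.
move=> frm; rewrite cubeE//; apply: measurable_preimage; first exact: measurable_coords.
rewrite (_ : [set _ | _] = (`[-1, 1]%classic `*` `[-1, 1]%classic) `*` `[-1, 1]%classic).
  by apply: measurableX => //; exact: measurableX.
by apply/seteqP; split => -[[x y] z] /=; [move=> []|move=> [[]]].
Qed.

Lemma measurable_tetra c u v w : measurable (tetra c u v w).
Proof.
apply: measurable_preimage; first exact: measurable_coords.
exact: measurable_std_tetra.
Qed.

Lemma frame_map_preimage c u v w (A : set (pt R)) : is_cube_frame c u v w ->
  frame_map c u v w @^-1` (coords c u v w @^-1` A) = A.
Proof.
by move=> frm; apply/seteqP; split => x /=; rewrite frame_mapK.
Qed.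

Lemma leb3_cube c u v w (k : R) : is_cube_frame c u v w -> 0 < k ->
  (forall A, measurable A -> leb3 (frame_map c u v w @^-1` A) = (k%:E * leb3 A)%E) ->
  leb3 (cube c u v w) = (8 / k)%:E.
Proof.
move=> frm k0 kE; have := kE _ (measurable_cube _ _ _ _ frm).
rewrite [in LHS]cubeE// frame_map_preimage// leb3_box lebesgue_measure_itv/=.
rewrite lte_fin (_ : (-1 < 1 :> R)); last by lra.
rewrite -EFinB -!EFinM => kC.
rewrite -[LHS]mul1e -(mulVf (lt0r_neq0 k0)) EFinM -muleA -kC -EFinM.
by congr EFin; field; rewrite gt_eqF.
Qed.

End frame.

(** * Bounds, measurability and the integral inequality on a tetrahedron of the cube *)

Lemma simplex_convex_bounded_below {R : realType} (h : pt R -> R) :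
  convex_on (simplex R) h -> exists m : R, forall p, simplex R p -> m <= h p.
Proof.
move=> hconv; have [M hM] := simplex_convex_bounded h hconv.
(* The centroid is [p / 4 + 3 q / 4] with [q] in the simplex. *)
pose b : pt R := (4^-1, 4^-1, 2^-1).
exists (4 * h b - 3 * M) => p Sp; case: (Sp) => p1 p2 p3 p4.
pose q := padd (pscale (4 / 3) b) (pscale (- (1 / 3)) p).
have Sq : simplex R q by split; rewrite /q /b /=; lra.
have -> : b = padd (pscale (4^-1) p) (pscale (1 - 4^-1) q).
  rewrite /q /b /padd /pscale /=; case: (p) => -[? ?] ?.
  by congr (_, _, _) => /=; field.
have t01 : 0 <= (4^-1 : R) <= 1 by apply/andP; split; lra.
by have := hconv p q 4^-1 Sp Sq t01; have := hM q Sq; lra.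
Qed.

Section tetra.
Context {R : realType}.
Variables (c u v w : pt R) (f : pt R -> R).
Hypothesis frm : is_cube_frame c u v w.
Hypothesis fconv : convex_on (tetra c u v w) f.

Let g := f \o frame_map c u v w.

Let tetra_frame_map x : std_tetra R x -> tetra c u v w (frame_map c u v w x).
Proof. by rewrite /tetra /preimage /mkset frame_mapK. Qed.

Let gconv : convex_on (std_tetra R) g.
Proof.
move=> x y t Sx Sy t01; rewrite /g /= frame_map_convex.
by apply: fconv => //; exact: tetra_frame_map.
Qed.

Lemma measurable_fun_tetra : measurable_fun (tetra c u v w) f.
Proof.
have -> : f = g \o coords c u v w by apply/funext => p; rewrite /g /= coordsK.
apply: (measurable_comp (F := std_tetra R)) (measurable_fun_std_tetra _ gconv) _.
- exact: measurable_std_tetra.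
- by move=> _ [p Tp <-].
- by apply: measurable_funTS; exact: measurable_coords.
Qed.

Lemma tetra_bounded : exists N : R, forall p, tetra c u v w p -> `|f p| <= N.
Proof.
have hconv := convex_of_simplex _ gconv.
have [M hM] := simplex_convex_bounded _ hconv.
have [m hm] := simplex_convex_bounded_below _ hconv.
exists (Num.max M (- m)) => p Tp.
have Sp : simplex R (to_simplex (coords c u v w p)).
  by rewrite -of_simplex_preimage /preimage /mkset to_simplexK.
have := hM _ Sp; have := hm _ Sp; rewrite /= to_simplexK /g /= coordsK// => h1 h2.
by rewrite ler_norml le_max h2 andbT lerNl le_max lerN2 h1 orbT.
Qed.

(** The factor 24 is 12 times 2: the tetrahedron has a twelfth of the volume of the cube, and the
    mean of two averages is taken. *)
Lemma tetra_integral_le : (forall p, tetra c u v w p -> 0 <= f p) ->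
  (\int[@leb3 R]_(p in tetra c u v w) (f p)%:E <=
   (fine (leb3 (cube c u v w)) / 24)%:E *
   (\int[lebesgue_measure]_(t in `[0%R, 1%R]) (f (cpt c u v w 1 (1 - 2 * t) 1))%:E +
    \int[lebesgue_measure]_(t in `[0%R, 1%R]) (f (cpt c u v w t (- t) (- t)))%:E))%E.
Proof.
move=> f0; have [k k0 kE] := leb3_frame_map _ _ _ _ frm.
rewrite (leb3_cube c u v w k)//=.
have := std_tetra_integral_le g gconv (fun p Sp => f0 _ (tetra_frame_map p Sp)).
have mf : measurable_fun (tetra c u v w) (fun p => (f p)%:E).
  by apply/measurable_EFinP; exact: measurable_fun_tetra.
rewrite -{1}(frame_map_preimage c u v w (std_tetra R) frm).
rewrite (ge0_integral_equivariant (@leb3 R) (frame_map c u v w) k (tetra c u v w)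
  (fun p => (f p)%:E) (measurable_frame_map c u v w) (ltW k0) kE
  (measurable_tetra c u v w) mf f0).
set I := (\int[@leb3 R]_(p in tetra c u v w) (f p)%:E)%E => le_kI.
have -> : I = (k^-1%:E * (k%:E * I))%E.
  by rewrite muleA -EFinM mulVf ?mul1e// gt_eqF.
apply: le_trans (lee_wpmul2l _ le_kI) _; first by rewrite lee_fin invr_ge0 ltW.
rewrite muleA -EFinM (_ : k^-1 * 3^-1 = 8 / k / 24); first exact: lexx.
by field; rewrite gt_eqF.
Qed.

End tetra.

(** * Signed permutations of a frame and the twelve tetrahedra *)

Lemma cpt_swap12 {R : realType} (c u v w : pt R) (x y z : R) :
  cpt c u v w x y z = cpt c v u w y x z.
Proof. by rewrite /cpt /padd /pscale /=; congr (_, _, _); ring. Qed.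

Lemma cpt_swap23 {R : realType} (c u v w : pt R) (x y z : R) :
  cpt c u v w x y z = cpt c u w v x z y.
Proof. by rewrite /cpt /padd /pscale /=; congr (_, _, _); ring. Qed.

Lemma cpt_scale {R : realType} (c u v w : pt R) (a b d x y z : R) :
  cpt c (pscale a u) (pscale b v) (pscale d w) x y z =
  cpt c u v w (x * a) (y * b) (z * d).
Proof. by rewrite /cpt /padd /pscale /=; congr (_, _, _); ring. Qed.

Lemma sign_itv {R : realType} (s x : R) : s = 1 \/ s = -1 ->
  (-1 <= x * s <= 1) = (-1 <= x <= 1).
Proof.
by move=> [|] ->; rewrite ?mulr1// mulrN1 lerN2 lerNl andbC.
Qed.

Lemma signM {R : realType} (s t : R) : s = 1 \/ s = -1 -> t = 1 \/ t = -1 ->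
  s * t = 1 \/ s * t = -1.
Proof. by move=> [|] -> [|] ->; rewrite ?mulr1 ?mulrN1 ?opprK; auto. Qed.

Lemma is_cube_frame_swap12 {R : realType} (c u v w : pt R) :
  is_cube_frame c u v w -> is_cube_frame c v u w.
Proof.
move=> [a [a0 [uu [vv [ww [uv [uw vw]]]]]]]; exists a.
by rewrite (_ : pdot v u = pdot u v)//; rewrite /pdot; ring.
Qed.

Lemma is_cube_frame_swap23 {R : realType} (c u v w : pt R) :
  is_cube_frame c u v w -> is_cube_frame c u w v.
Proof.
move=> [a [a0 [uu [vv [ww [uv [uw vw]]]]]]]; exists a.
by rewrite (_ : pdot w v = pdot v w)//; rewrite /pdot; ring.
Qed.

Lemma is_cube_frame_sign {R : realType} (c u v w : pt R) (s1 s2 s3 : R) :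
  (s1 = 1 \/ s1 = -1) -> (s2 = 1 \/ s2 = -1) -> (s3 = 1 \/ s3 = -1) ->
  is_cube_frame c u v w ->
  is_cube_frame c (pscale s1 u) (pscale s2 v) (pscale s3 w).
Proof.
have dotZ a b p q : pdot (pscale a p) (pscale b q) = a * b * pdot p q :> R.
  by rewrite /pdot /pscale /=; ring.
have sq (s : R) : s = 1 \/ s = -1 -> s * s = 1.
  by move=> [|] ->; rewrite ?mulr1// mulrNN mulr1.
move=> h1 h2 h3 [a [a0 [uu [vv [ww [uv [uw vw]]]]]]]; exists a.
by rewrite !dotZ !sq// !mul1r uu vv ww uv uw vw !mulr0.
Qed.

Lemma cube_swap12 {R : realType} (c u v w : pt R) : cube c u v w = cube c v u w.
Proof.
by apply/seteqP; split => p [x [y [z [xI yI zI ->]]]]; exists y, x, z;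
  split => //; exact: cpt_swap12.
Qed.

Lemma cube_swap23 {R : realType} (c u v w : pt R) : cube c u v w = cube c u w v.
Proof.
by apply/seteqP; split => p [x [y [z [xI yI zI ->]]]]; exists x, z, y;
  split => //; exact: cpt_swap23.
Qed.

Lemma cube_sign {R : realType} (c u v w : pt R) (s1 s2 s3 : R) :
  (s1 = 1 \/ s1 = -1) -> (s2 = 1 \/ s2 = -1) -> (s3 = 1 \/ s3 = -1) ->
  cube c (pscale s1 u) (pscale s2 v) (pscale s3 w) = cube c u v w.
Proof.
have sq (s x : R) : s = 1 \/ s = -1 -> x * s * s = x.
  by move=> [|] ->; rewrite ?mulr1// mulrN1 mulrN1 opprK.
move=> h1 h2 h3; apply/seteqP; split => p [x [y [z [xI yI zI ->]]]];
  exists (x * s1), (y * s2), (z * s3); rewrite !sign_itv//; split => //.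
  exact: cpt_scale.
by rewrite cpt_scale !sq.
Qed.

(* The tetrahedra of the twelve frames tile the cube. *)
Definition frames6 {R : realType} (u v w : pt R) : seq (pt R * pt R * pt R) :=
  [:: (u, v, w); (u, w, v); (v, u, w); (v, w, u); (w, u, v); (w, v, u)].

(** The frames obtained by the symmetries of the cube that preserve the pair [V], [W]: permutations
    fix both vertices, a global sign change exchanges them. *)
Definition frames {R : realType} (u v w : pt R) : seq (pt R * pt R * pt R) :=
  frames6 u v w ++ frames6 (pscale (-1) u) (pscale (-1) v) (pscale (-1) w).

(** The two swaps generate all permutations, so that invariance under three generators suffices. *)
Lemma frames_ind {R : realType} (P : pt R -> pt R -> pt R -> Prop) (u v w : pt R) :
  (forall u v w, P u v w -> P v u w) -> (forall u v w, P u v w -> P u w v) ->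
  (forall u v w, P u v w -> P (pscale (-1) u) (pscale (-1) v) (pscale (-1) w)) ->
  P u v w -> forall fr, fr \in frames u v w -> P fr.1.1 fr.1.2 fr.2.
Proof.
move=> P12 P23 PN Puvw.
have P6 u' v' w' : P u' v' w' -> forall fr, fr \in frames6 u' v' w' ->
    P fr.1.1 fr.1.2 fr.2.
  move=> P0 fr; rewrite !inE => /or4P[/eqP ->|/eqP ->|/eqP ->|] /=; auto.
  by move=> /or3P[/eqP ->|/eqP ->|/eqP ->] /=; auto.
by move=> fr; rewrite mem_cat => /orP[]; apply: P6; auto.
Qed.

Lemma framesP {R : realType} (c u v w : pt R) fr : is_cube_frame c u v w ->
  fr \in frames u v w ->
  is_cube_frame c fr.1.1 fr.1.2 fr.2 /\ cube c fr.1.1 fr.1.2 fr.2 = cube c u v w.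
Proof.
have m1 : -1 = 1 :> R \/ -1 = -1 :> R by right.
move=> frm; move: fr; apply: (frames_ind (fun u' v' w' =>
  is_cube_frame c u' v' w' /\ cube c u' v' w' = cube c u v w)) => //.
- move=> u' v' w' [h <-]; rewrite cube_swap12; split => //.
  exact: is_cube_frame_swap12.
- move=> u' v' w' [h <-]; rewrite cube_swap23; split => //.
  exact: is_cube_frame_swap23.
- move=> u' v' w' [h <-]; rewrite cube_sign//; split => //.
  exact: is_cube_frame_sign.
Qed.

Lemma tetra_cpt {R : realType} (c u v w : pt R) (x y z : R) :
  is_cube_frame c u v w -> std_tetra R (x, y, z) ->
  tetra c u v w (cpt c u v w x y z).
Proof.
move=> frm Sx; rewrite /tetra /preimage /mkset.
by have -> : coords c u v w (cpt c u v w x y z) = (x, y, z)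
  by exact: (frame_mapK _ _ _ _ frm (x, y, z)).
Qed.

Lemma tetraP {R : realType} (c u v w : pt R) (p : pt R) :
  is_cube_frame c u v w -> tetra c u v w p ->
  exists x y z, std_tetra R (x, y, z) /\ p = cpt c u v w x y z.
Proof.
move=> frm Tp; exists (coords c u v w p).1.1, (coords c u v w p).1.2,
  (coords c u v w p).2; split; last exact: esym (coordsK _ _ _ _ frm p).
by move: Tp; rewrite /tetra /preimage /mkset; case: coords => -[].
Qed.

Lemma tetra_sub_cube {R : realType} (c u v w : pt R) : is_cube_frame c u v w ->
  tetra c u v w `<=` cube c u v w.
Proof.
move=> frm p /(tetraP _ _ _ _ _ frm)[x [y [z [[/= h1 h2 h3 h4] ->]]]].
by exists x, y, z; split => //; apply/andP; split; lra.
Qed.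

(** The coordinate of largest absolute value and its sign select the face, and comparing the other
    two coordinates selects the half of that face. *)
Lemma cube_cover {R : realType} (c u v w : pt R) p : is_cube_frame c u v w ->
  cube c u v w p ->
  exists2 fr, fr \in frames u v w & tetra c fr.1.1 fr.1.2 fr.2 p.
Proof.
move=> frm [x [y [z [/andP[x1 x2] /andP[y1 y2] /andP[z1 z2] pE]]]].
have tet fr a b d : fr \in frames u v w -> p = cpt c fr.1.1 fr.1.2 fr.2 a b d ->
    [/\ - a <= b, b <= d, d <= a & a <= 1] ->
    exists2 fr, fr \in frames u v w & tetra c fr.1.1 fr.1.2 fr.2 p.
  move=> frin -> abd; exists fr => //; apply: tetra_cpt => //.
  by case: (framesP c u v w fr frm frin).
have cases : [\/ [/\ - `|x| <= y, y <= `|x|, - `|x| <= z & z <= `|x| ],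
    [/\ - `|y| <= x, x <= `|y|, - `|y| <= z & z <= `|y| ] |
    [/\ - `|z| <= x, x <= `|z|, - `|z| <= y & y <= `|z| ]].
  have bnd (a b : R) : `|a| <= `|b| -> - `|b| <= a /\ a <= `|b|.
    by rewrite ler_norml => /andP.
  have [xy|/ltW yx] := leP `|x| `|y|; have [yz|/ltW zy] := leP `|y| `|z|.
  - have [? ?] := bnd _ _ (le_trans xy yz); have [? ?] := bnd _ _ yz.
    by apply: Or33.
  - have [? ?] := bnd _ _ xy; have [? ?] := bnd _ _ zy.
    by apply: Or32.
  - have [xz|/ltW zx] := leP `|x| `|z|.
      have [? ?] := bnd _ _ xz; have [? ?] := bnd _ _ yz.
      by apply: Or33.
    have [? ?] := bnd _ _ yx; have [? ?] := bnd _ _ zx.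
    by apply: Or31.
  - have [? ?] := bnd _ _ yx; have [? ?] := bnd _ _ (le_trans zy yx).
    by apply: Or31.
have ring3 q1 q2 q3 d1 d2 d3 : q1 = d1 :> R -> q2 = d2 :> R -> q3 = d3 :> R ->
    (q1, q2, q3) = (d1, d2, d3) by move=> -> -> ->.
case: cases => -[h1 h2 h3 h4].
- have [x0|x0] := leP 0 x; [rewrite ger0_norm// in h1 h2 h3 h4|rewrite ltr0_norm// in h1 h2 h3 h4].
  + have [bd|/ltW db] := leP y z.
    * apply: (tet (u, v, w) x y z).
      - by rewrite /frames !inE !eqxx ?orbT.
      - by rewrite pE /cpt /padd /pscale /=; apply: ring3; ring.
      - by split; lra.
    * apply: (tet (u, w, v) x z y).
      - by rewrite /frames !inE !eqxx ?orbT.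
      - by rewrite pE /cpt /padd /pscale /=; apply: ring3; ring.
      - by split; lra.
  (* On the opposite face all coordinates are negated, which reverses the comparison; the last two
     vectors trade places relative to the positive case. *)
  + have [bd|/ltW db] := leP y z.
    * apply: (tet (pscale (-1) u, pscale (-1) w, pscale (-1) v) (- x) (- z) (- y)).
      - by rewrite /frames !inE !eqxx ?orbT.
      - by rewrite pE /cpt /padd /pscale /=; apply: ring3; ring.
      - by split; lra.
    * apply: (tet (pscale (-1) u, pscale (-1) v, pscale (-1) w) (- x) (- y) (- z)).
      - by rewrite /frames !inE !eqxx ?orbT.
      - by rewrite pE /cpt /padd /pscale /=; apply: ring3; ring.
      - by split; lra.
- have [y0|y0] := leP 0 y; [rewrite ger0_norm// in h1 h2 h3 h4|rewrite ltr0_norm// in h1 h2 h3 h4].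
  + have [bd|/ltW db] := leP x z.
    * apply: (tet (v, u, w) y x z).
      - by rewrite /frames !inE !eqxx ?orbT.
      - by rewrite pE /cpt /padd /pscale /=; apply: ring3; ring.
      - by split; lra.
    * apply: (tet (v, w, u) y z x).
      - by rewrite /frames !inE !eqxx ?orbT.
      - by rewrite pE /cpt /padd /pscale /=; apply: ring3; ring.
      - by split; lra.
  + have [bd|/ltW db] := leP x z.
    * apply: (tet (pscale (-1) v, pscale (-1) w, pscale (-1) u) (- y) (- z) (- x)).
      - by rewrite /frames !inE !eqxx ?orbT.
      - by rewrite pE /cpt /padd /pscale /=; apply: ring3; ring.
      - by split; lra.
    * apply: (tet (pscale (-1) v, pscale (-1) u, pscale (-1) w) (- y) (- x) (- z)).
      - by rewrite /frames !inE !eqxx ?orbT.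
      - by rewrite pE /cpt /padd /pscale /=; apply: ring3; ring.
      - by split; lra.
- have [z0|z0] := leP 0 z; [rewrite ger0_norm// in h1 h2 h3 h4|rewrite ltr0_norm// in h1 h2 h3 h4].
  + have [bd|/ltW db] := leP x y.
    * apply: (tet (w, u, v) z x y).
      - by rewrite /frames !inE !eqxx ?orbT.
      - by rewrite pE /cpt /padd /pscale /=; apply: ring3; ring.
      - by split; lra.
    * apply: (tet (w, v, u) z y x).
      - by rewrite /frames !inE !eqxx ?orbT.
      - by rewrite pE /cpt /padd /pscale /=; apply: ring3; ring.
      - by split; lra.
  + have [bd|/ltW db] := leP x y.
    * apply: (tet (pscale (-1) w, pscale (-1) v, pscale (-1) u) (- z) (- y) (- x)).
      - by rewrite /frames !inE !eqxx ?orbT.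
      - by rewrite pE /cpt /padd /pscale /=; apply: ring3; ring.
      - by split; lra.
    * apply: (tet (pscale (-1) w, pscale (-1) u, pscale (-1) v) (- z) (- x) (- y)).
      - by rewrite /frames !inE !eqxx ?orbT.
      - by rewrite pE /cpt /padd /pscale /=; apply: ring3; ring.
      - by split; lra.
Qed.

(** * Each tetrahedron lies in a pyramid *)

Lemma convex_on_sub {R : realType} (A B : set (pt R)) (f : pt R -> R) :
  A `<=` B -> convex_on B f -> convex_on A f.
Proof. by move=> AB fB x y t Ax Ay t01; apply: fB => //; exact: AB. Qed.

(* [e1 e2 e3] is the frame of the cube, [u v w] a signed permutation of it. *)
Definition in_face {R : realType} (c e1 e2 e3 u v w : pt R) :=
  exists i : 'I_3, exists2 sg : R, sg = 1 \/ sg = -1 &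
  forall y z, -1 <= y <= 1 -> -1 <= z <= 1 ->
    cube_face c e1 e2 e3 i sg (cpt c u v w 1 y z).

(** A statement about one face would not be stable under the swaps in [frames_ind], so all six faces
    are carried along together. *)
Definition in_faces {R : realType} (c e1 e2 e3 u v w : pt R) :=
  forall t : R, t = 1 \/ t = -1 ->
  [/\ in_face c e1 e2 e3 (pscale t u) v w, in_face c e1 e2 e3 (pscale t v) u w &
      in_face c e1 e2 e3 (pscale t w) u v].

Section faces.
Context {R : realType}.
Variables (c e1 e2 e3 : pt R).
Implicit Types u v w : pt R.

Let face := in_face c e1 e2 e3.

Lemma in_face_swap u v w : face u v w -> face u w v.
Proof.
move=> [i [sg hsg H]]; exists i, sg => // y z yI zI.
by rewrite cpt_swap23; exact: H.
Qed.

Lemma in_face_sign u v w (s t : R) : s = 1 \/ s = -1 -> t = 1 \/ t = -1 ->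
  face u v w -> face u (pscale s v) (pscale t w).
Proof.
move=> hs ht [i [sg hsg H]]; exists i, sg => // y z yI zI.
have -> : cpt c u (pscale s v) (pscale t w) 1 y z = cpt c u v w 1 (y * s) (z * t).
  by rewrite /cpt /padd /pscale /=; congr (_, _, _); ring.
by apply: H; rewrite sign_itv.
Qed.

Lemma in_faces_frames u v w : in_faces c e1 e2 e3 u v w ->
  forall fr, fr \in frames u v w -> in_faces c e1 e2 e3 fr.1.1 fr.1.2 fr.2.
Proof.
apply: frames_ind.
- move=> u' v' w' H t ht; have [h1 h2 h3] := H t ht.
  by split => //; exact: in_face_swap.
- move=> u' v' w' H t ht; have [h1 h2 h3] := H t ht.
  by split => //; exact: in_face_swap.
- have m1 : -1 = 1 :> R \/ -1 = -1 :> R by right.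
  move=> u' v' w' H t ht; have [h1 h2 h3] := H _ (signM _ _ ht m1).
  have scaleA p : pscale t (pscale (-1) p) = pscale (t * -1) p :> pt R.
    by rewrite /pscale /=; congr (_, _, _); ring.
  by rewrite !scaleA; split; exact: in_face_sign.
Qed.

Lemma in_faces_sign (s1 s2 s3 : R) :
  (s1 = 1 \/ s1 = -1) -> (s2 = 1 \/ s2 = -1) -> (s3 = 1 \/ s3 = -1) ->
  in_faces c e1 e2 e3 (pscale s1 e1) (pscale s2 e2) (pscale s3 e3).
Proof.
have ring3 (q1 q2 q3 d1 d2 d3 : R) : q1 = d1 -> q2 = d2 -> q3 = d3 ->
    (q1, q2, q3) = (d1, d2, d3) by move=> -> -> ->.
have sgn (s : R) : s = 1 \/ s = -1 -> -1 <= s <= 1.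
  by move=> [|] ->; apply/andP; split; lra.
move=> h1 h2 h3 t ht; split.
- exists (@Ordinal 3 0 isT), (t * s1); first exact: signM.
  move=> y z yI zI; exists (t * s1), (y * s2), (z * s3).
  rewrite !sign_itv//; split=> //; first exact: sgn.
  by rewrite /cpt /padd /pscale /=; apply: ring3; ring.
- exists (@Ordinal 3 1 isT), (t * s2); first exact: signM.
  move=> y z yI zI; exists (y * s1), (t * s2), (z * s3).
  rewrite !sign_itv//; split=> //; first exact: sgn.
  by rewrite /cpt /padd /pscale /=; apply: ring3; ring.
- exists (@Ordinal 3 2 isT), (t * s3); first exact: signM.
  move=> y z yI zI; exists (y * s1), (z * s2), (t * s3).
  rewrite !sign_itv//; split=> //; first exact: sgn.
  by rewrite /cpt /padd /pscale /=; apply: ring3; ring.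
Qed.

Lemma convex_on_tetra u v w (f : pt R -> R) :
  (forall (i : 'I_3) (sg : R), (sg = 1 \/ sg = -1) ->
     convex_on (pyramid c (cube_face c e1 e2 e3 i sg)) f) ->
  is_cube_frame c u v w -> in_faces c e1 e2 e3 u v w ->
  convex_on (tetra c u v w) f.
Proof.
move=> fconv frm faces.
have [[i [sg hsg H]] _ _] := faces 1 (or_introl erefl).
apply: convex_on_sub (fconv i sg hsg).
move=> p /(tetraP _ _ _ _ _ frm)[x [y [z [[/= h1 h2 h3 h4] ->]]]].
(* The point [(x, y, z)] lies at parameter [x] on the segment from [O] to the face point
   [(1, y / x, z / x)]. At the apex [x = 0] the other coordinates vanish too, and the quotients are
   0 by convention. *)
have ratio a : - x <= a -> a <= x -> -1 <= a / x <= 1 /\ x * (a / x) = a.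
  move=> a1 a2; have [x0|x0] := eqVneq x 0.
    by rewrite x0 invr0 mulr0 mul0r; split; [apply/andP; split|]; lra.
  have xgt0 : 0 < x by rewrite lt_neqAle eq_sym x0/=; lra.
  split; last by rewrite mulrC divfK.
  by rewrite ler_pdivlMr// ler_pdivrMr//; apply/andP; split; lra.
have [yI yE] := ratio y h1 (le_trans h2 h3).
have [zI zE] := ratio z (le_trans h1 h2) h3.
exists x, (cpt c u v w 1 (y / x) (z / x)); split; [|split].
- by apply/andP; split; lra.
- have := H _ _ yI zI; rewrite (_ : pscale 1 u = u)//.
  by case: (u) => -[? ?] ?; rewrite /pscale /= !mul1r.
- rewrite -[in LHS]yE -[in LHS]zE; move: (y / x) (z / x) => y' z'.
  by rewrite /cpt /padd /pscale /=; congr (_, _, _); ring.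
Qed.

End faces.

(** * From the tetrahedra to the integral over the cube *)

Lemma integrable_bounded_cst {d} {T : measurableType d} {R : realType}
    (mu : {measure set T -> \bar R}) (D : set T) (N : R) :
  measurable D -> (mu D < +oo)%E -> mu.-integrable D (EFin \o (fun=> N)).
Proof.
move=> mD Dfin; apply: (measurable_bounded_integrable mD Dfin).
  exact: measurable_cst.
exists `|N|; split; first exact: num_real.
by move=> x Nx p _; exact: ltW.
Qed.

Section tetra_path.
Context {R : realType}.
Variables (c u v w : pt R) (f : pt R -> R).
Hypothesis frm : is_cube_frame c u v w.
Hypothesis fconv : convex_on (tetra c u v w) f.

Lemma integrable_tetra_path (g : R -> pt R) : measurable_fun setT g ->
  (forall t, 0 <= t <= 1 -> tetra c u v w (g t)) ->
  (@lebesgue_measure R).-integrable `[0, 1] (EFin \o (f \o g)).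
Proof.
move=> mg gT; have [N hN] := tetra_bounded _ _ _ _ _ frm fconv.
have leb1 : (lebesgue_measure `[0%R, 1%R : R]%classic < +oo)%E.
  by rewrite lebesgue_measure_itv/= lte_fin ltr01 sube0 ltry.
apply: (measurable_bounded_integrable (mu := @lebesgue_measure R) (f := f \o g)
  _ leb1).
- exact: measurable_itv.
- apply: (measurable_comp (F := tetra c u v w))
    (measurable_fun_tetra _ _ _ _ _ frm fconv) _.
  + exact: measurable_tetra.
  + by move=> _ [t /= + <-]; rewrite in_itv/=; exact: gT.
  + exact: measurable_funTS.
- exists N; split; first exact: num_real.
  move=> x Nx t /=; rewrite in_itv/= => t01.
  exact: le_trans (hN _ (gT _ t01)) (ltW Nx).
Qed.

(** Since the parameter runs over an interval of length one, this and [diag_integral] are averages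
    over the edge and the half diagonal. *)
Definition edge_integral := \int[@lebesgue_measure R]_(t in `[0, 1])
  f (cpt c u v w 1 (1 - 2 * t) 1).

Definition diag_integral := \int[@lebesgue_measure R]_(t in `[0, 1])
  f (cpt c u v w t (- t) (- t)).

Lemma integrable_edge : (@lebesgue_measure R).-integrable `[0, 1]
  (EFin \o (fun t => f (cpt c u v w 1 (1 - 2 * t) 1))).
Proof.
apply: (integrable_tetra_path (fun t => cpt c u v w 1 (1 - 2 * t) 1)).
  apply: (measurableT_comp (measurable_frame_map c u v w)
    (g := fun t : R => (1, 1 - 2 * t, 1) : pt R)).
  apply: measurable_pt_fun => //=.
  by apply: measurable_funB => //; exact: measurable_funM.
by move=> t /andP[? ?]; apply: tetra_cpt => //; split => /=; lra.
Qed.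

Lemma integrable_diag : (@lebesgue_measure R).-integrable `[0, 1]
  (EFin \o (fun t => f (cpt c u v w t (- t) (- t)))).
Proof.
apply: (integrable_tetra_path (fun t => cpt c u v w t (- t) (- t))).
  apply: (measurableT_comp (measurable_frame_map c u v w)
    (g := fun t : R => (t, - t, - t) : pt R)).
  by apply: measurable_pt_fun => //=; exact: measurableT_comp.
by move=> t /andP[? ?]; apply: tetra_cpt => //; split => /=; lra.
Qed.

Lemma edge_diag_integralE :
  (\int[lebesgue_measure]_(t in `[0%R, 1%R]) (f (cpt c u v w 1 (1 - 2 * t) 1))%:E +
   \int[lebesgue_measure]_(t in `[0%R, 1%R]) (f (cpt c u v w t (- t) (- t)))%:E =
   (edge_integral + diag_integral)%:E)%E.
Proof.
rewrite EFinD /edge_integral /diag_integral /Rintegral !fineK//.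
- exact: integrable_fin_num integrable_diag.
- exact: integrable_fin_num integrable_edge.
Qed.

End tetra_path.

Section cube_integral.
Context {R : realType}.
Variables (c u v w : pt R).
Hypothesis frm : is_cube_frame c u v w.

(** The default is itself one of the frames, so every index yields a frame and no bound on [i] has
    to be carried. *)
Definition frame_nth i := nth (u, v, w) (frames u v w) i.

Lemma frame_nth_in i : frame_nth i \in frames u v w.
Proof.
rewrite /frame_nth; have [/mem_nth->//|ge_size] := ltnP i (size (frames u v w)).
by rewrite nth_default// /frames !inE eqxx.
Qed.

Definition tetra_nth i :=
  tetra c (frame_nth i).1.1 (frame_nth i).1.2 (frame_nth i).2.

Let frm_nth i :
  is_cube_frame c (frame_nth i).1.1 (frame_nth i).1.2 (frame_nth i).2.
Proof. by case: (framesP _ _ _ _ _ frm (frame_nth_in i)). Qed.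

Let cube_nth i :
  cube c (frame_nth i).1.1 (frame_nth i).1.2 (frame_nth i).2 = cube c u v w.
Proof. by case: (framesP _ _ _ _ _ frm (frame_nth_in i)). Qed.

Let tetra_nth_cube i : tetra_nth i `<=` cube c u v w.
Proof. by rewrite -(cube_nth i); exact: tetra_sub_cube. Qed.

Let cube_nth_cover p : cube c u v w p -> exists2 i, (i < 12)%N & tetra_nth i p.
Proof.
move=> /(cube_cover _ _ _ _ _ frm)[fr frin Tp].
exists (index fr (frames u v w)); first by move: frin; rewrite -index_mem.
by rewrite /tetra_nth /frame_nth nth_index.
Qed.

Let cube_volume : exists2 k : R, 0 < k & leb3 (cube c u v w) = k%:E.
Proof.
have [k k0 kE] := leb3_frame_map _ _ _ _ frm.
by exists (8 / k); [rewrite divr_gt0|exact: leb3_cube kE].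
Qed.

Section convex_function.
Variable f : pt R -> R.
Hypothesis fconv : forall fr, fr \in frames u v w ->
  convex_on (tetra c fr.1.1 fr.1.2 fr.2) f.

Let fconv_nth i : convex_on (tetra_nth i) f.
Proof. exact: fconv (frame_nth_in i). Qed.

Lemma measurable_fun_cube : measurable_fun (cube c u v w) f.
Proof.
have -> : cube c u v w = \bigcup_i tetra_nth i.
  apply/seteqP; split => [p /cube_nth_cover[i _ Tp]|p [i _]].
    by exists i.
  exact: tetra_nth_cube.
apply/measurable_fun_bigcup => i; first exact: measurable_tetra.
exact: (measurable_fun_tetra _ _ _ _ _ (frm_nth i) (fconv_nth i)).
Qed.

Lemma cube_bounded : exists N : R, forall p, cube c u v w p -> `|f p| <= N.
Proof.
have bnd n : exists N : R, forall i p, (i < n)%N -> tetra_nth i p -> `|f p| <= N.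
  elim: n => [|n [N hN]]; first by exists 0.
  have [M hM] := tetra_bounded _ _ _ _ _ (frm_nth n) (fconv_nth n).
  exists (Num.max N M) => i p; rewrite ltnS leq_eqVlt => /predU1P[->|i_n] Tp.
    by rewrite le_max (hM _ Tp) orbT.
  by rewrite le_max (hN i).
have [N hN] := bnd 12; exists N => p /cube_nth_cover[i i12 Tp].
exact: hN i12 Tp.
Qed.

Lemma integrable_cube : (@leb3 R).-integrable (cube c u v w) (EFin \o f).
Proof.
have [N hN] := cube_bounded; have [k _ kE] := cube_volume.
have fin : (leb3 (cube c u v w) < +oo)%E by rewrite kE ltry.
apply: (measurable_bounded_integrable (mu := @leb3 R) (f := f)
  _ fin).
- exact: measurable_cube.
- exact: measurable_fun_cube.
- exists N; split; first exact: num_real.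
  by move=> x Nx p /hN hp; exact: le_trans hp (ltW Nx).
Qed.

Definition edges_diags := \sum_(i < 12)
  (edge_integral c (frame_nth i).1.1 (frame_nth i).1.2 (frame_nth i).2 f +
   diag_integral c (frame_nth i).1.1 (frame_nth i).1.2 (frame_nth i).2 f).

(** As [f] is nonnegative, its restriction to the cube is at most the sum of its restrictions to the
    twelve covering tetrahedra; no disjointness has to be checked. *)
Lemma ge0_cube_integral_le : (forall p, cube c u v w p -> 0 <= f p) ->
  \int[@leb3 R]_(p in cube c u v w) f p <=
  fine (leb3 (cube c u v w)) / 24 * edges_diags.
Proof.
move=> f0; rewrite /Rintegral -lee_fin fineK; last first.
  by apply: integrable_fin_num; [exact: measurable_cube|exact: integrable_cube].
pose F i := (EFin \o f) \_ (tetra_nth i).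
have mF i : measurable_fun setT (F i).
  apply/(measurable_restrictT _ (measurable_tetra _ _ _ _))/measurable_EFinP.
  exact: (measurable_fun_tetra _ _ _ _ _ (frm_nth i) (fconv_nth i)).
have F0 i p : (0 <= F i p)%E.
  by apply: erestrict_ge0 => q /tetra_nth_cube Cq; rewrite lee_fin f0.
apply: (@le_trans _ _ (\int[@leb3 R]_p \sum_(i <- iota 0 12) F i p)%E).
  rewrite integral_mkcond; apply: (ge0_le_integral (@leb3 R) measurableT
    (f1 := (EFin \o f) \_ (cube c u v w))
    (f2 := fun p => \sum_(i <- iota 0 12) F i p)%E).
  - by move=> p _; apply: erestrict_ge0 => q Cq; rewrite lee_fin f0.
  - apply/(measurable_restrictT _ (measurable_cube _ _ _ _ frm))/measurable_EFinP.
    exact: measurable_fun_cube.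
  - exact: emeasurable_sum.
  - move=> p _; rewrite patchE; case: ifPn => [|_]; last by apply: sume_ge0.
    rewrite inE => /cube_nth_cover[i i12 Tp].
    rewrite (big_rem i) ?mem_iota//= [X in (_ <= X + _)%E](_ : _ = (f p)%:E).
      by rewrite leeDl// sume_ge0.
    by rewrite /F patchE mem_set.
rewrite ge0_integral_sum//.
rewrite -[iota 0 12]/(index_iota 0 12) big_mkord.
rewrite /edges_diags big_distrr /= -sumEFin; apply: lee_sum => i _.
rewrite -integral_mkcond EFinM
  -(edge_diag_integralE _ _ _ _ f (frm_nth i) (fconv_nth i)) -(cube_nth i).
apply: (tetra_integral_le _ _ _ _ f (frm_nth i) (fconv_nth i)) => p Tp.
by apply: f0; exact: tetra_nth_cube Tp.
Qed.

End convex_function.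

(** Adding a bound [N] makes [f] nonnegative. Both sides grow by [N] times the volume, because
    [edges_diags] sums 24 averages. *)
Lemma cube_integral_le (f : pt R -> R) :
  (forall fr, fr \in frames u v w -> convex_on (tetra c fr.1.1 fr.1.2 fr.2) f) ->
  \int[@leb3 R]_(p in cube c u v w) f p <=
  fine (leb3 (cube c u v w)) / 24 * edges_diags f.
Proof.
move=> fconv; have [N hN] := cube_bounded f fconv; have [k k0 kE] := cube_volume.
pose h p := f p + N.
have hconv fr : fr \in frames u v w -> convex_on (tetra c fr.1.1 fr.1.2 fr.2) h.
  by move=> frin x y t Tx Ty t01; have := fconv fr frin x y t Tx Ty t01; rewrite /h; lra.
have h0 p : cube c u v w p -> 0 <= h p.
  by move=> /hN; rewrite ler_norml /h => /andP[]; lra.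
have := ge0_cube_integral_le h hconv h0.
have path (g : R -> pt R) :
    (@lebesgue_measure R).-integrable `[0, 1] (EFin \o (f \o g)) ->
    \int[@lebesgue_measure R]_(t in `[0, 1]) h (g t) =
    \int[@lebesgue_measure R]_(t in `[0, 1]) f (g t) + N.
  have leb1 : lebesgue_measure `[0%R, 1%R : R]%classic = 1%E.
    by rewrite lebesgue_measure_itv/= lte_fin ltr01 sube0.
  move=> gi; rewrite /h RintegralD//; last first.
    have fin1 : (lebesgue_measure `[0%R, 1%R : R]%classic < +oo)%E.
      by rewrite leb1 ltry.
    exact: (integrable_bounded_cst (@lebesgue_measure R) _ N (measurable_itv _) fin1).
  by rewrite Rintegral_cst// [X in fine X]leb1 mulr1.
have -> : edges_diags h = edges_diags f + 24 * N.
  rewrite /edges_diags (eq_bigr (fun i : 'I_12 =>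
    (edge_integral c (frame_nth i).1.1 (frame_nth i).1.2 (frame_nth i).2 f +
     diag_integral c (frame_nth i).1.1 (frame_nth i).1.2 (frame_nth i).2 f)
    + 2 * N)).
    rewrite big_split /= sumr_const card_ord -mulr_natr; congr (_ + _); ring.
  move=> i _; rewrite /edge_integral /diag_integral.
  rewrite (path (fun t => cpt c _ _ _ 1 (1 - 2 * t) 1)); last first.
    by apply: integrable_edge => //; exact: fconv (frame_nth_in i).
  rewrite (path (fun t => cpt c _ _ _ t (- t) (- t))); last first.
    by apply: integrable_diag => //; exact: fconv (frame_nth_in i).
  ring.
rewrite RintegralD; last 3 first.
- exact: measurable_cube.
- exact: integrable_cube.
- have fin : (leb3 (cube c u v w) < +oo)%E by rewrite kE ltry.
  exact: (integrable_bounded_cst (@leb3 R) _ N (measurable_cube _ _ _ _ frm) fin).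
rewrite Rintegral_cst; last exact: measurable_cube.
rewrite [X in _ + N * fine X]kE kE /= mulrDr => H.
have kN : k / 24 * (24 * N) = N * k by field.
by move: H; rewrite kN lerD2r.
Qed.

End cube_integral.

(** * Integrals along edges and diagonals *)

(** The change of variables for nonnegative functions is applied to the positive and negative parts;
    integrability gives meaning to their difference. *)
Lemma Rintegral_affine {R : realType} (F : R -> R) (a b : R) (D : set R) :
  a != 0 -> measurable D -> (@lebesgue_measure R).-integrable D (EFin \o F) ->
  \int[@lebesgue_measure R]_(t in (fun t => a * t + b) @^-1` D) F (a * t + b) =
  `|a^-1| * \int[@lebesgue_measure R]_(t in D) F t.
Proof.
move=> a0 mD intF; have /integrableP[mF _] := intF.
have mphi : measurable_fun [set: measurableTypeR R]
    ((fun t => a * t + b) : measurableTypeR R -> measurableTypeR R).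
  exact: measurable_funD.
have equiv (G : R -> \bar R) : measurable_fun D G -> (forall t, 0 <= G t)%E ->
    (\int[@lebesgue_measure R]_(t in (fun t => a * t + b)%R @^-1` D) G (a * t + b)%R =
     `|a^-1|%:E * \int[@lebesgue_measure R]_(t in D) G t)%E.
  move=> mG G0; apply: (ge0_integral_equivariant (@lebesgue_measure R)
    (fun t => a * t + b) `|a^-1| D G mphi (normr_ge0 _)) => //.
  by move=> A mA; exact: lebesgue_measure_affine.
transitivity (fine (`|a^-1|%:E * \int[@lebesgue_measure R]_(t in D) (F t)%:E)%E);
    last first.
  by rewrite fineM//; exact: integrable_fin_num intF.
congr fine; rewrite integralE [in RHS]integralE.
rewrite muleBr//; last first.
  apply: fin_num_adde_defr; exact: integrable_pos_fin_num intF.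
rewrite -!equiv//.
- by congr (_ - _)%E; apply: eq_integral => t _; rewrite unlock.
- exact: measurable_funeneg.
- exact: measurable_funepos.
Qed.

(** Splits a diagonal at [O]: both substitutions start at the midpoint and run outwards, as
    [diag_integral] does. *)
Lemma Rintegral_halves {R : realType} (F : R -> R) :
  (@lebesgue_measure R).-integrable `[0, 1] (EFin \o F) ->
  \int[@lebesgue_measure R]_(t in `[0, 1]) F (2^-1 * t + 2^-1) +
  \int[@lebesgue_measure R]_(t in `[0, 1]) F (- 2^-1 * t + 2^-1) =
  2 * \int[@lebesgue_measure R]_(t in `[0, 1]) F t.
Proof.
move=> intF.
have int1 : (@lebesgue_measure R).-integrable `[0, 2^-1] (EFin \o F).
  apply: integrableS intF => //; apply: subset_itvl; rewrite bnd_simp; lra.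
have int2 : (@lebesgue_measure R).-integrable `[2^-1, 1] (EFin \o F).
  apply: integrableS intF => //; apply: subset_itvr; rewrite bnd_simp; lra.
have two : `|(2^-1)^-1| = 2 :> R by rewrite invrK ger0_norm.
have twoN : `|(- 2^-1)^-1| = 2 :> R by rewrite invrN invrK normrN ger0_norm.
have n0 : 2^-1 != 0 :> R by rewrite invr_eq0.
have nN0 : - 2^-1 != 0 :> R by rewrite oppr_eq0.
have := Rintegral_affine F 2^-1 2^-1 `[2^-1, 1]%classic n0 (measurable_itv _) int2.
rewrite two (_ : _ @^-1` _ = `[0, 1]%classic) => [->|]; last first.
  by apply/seteqP; split => t /=; rewrite !in_itv/= => /andP[? ?];
    apply/andP; split; lra.
have := Rintegral_affine F (- 2^-1) 2^-1 `[0, 2^-1]%classic nN0 (measurable_itv _) int1.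
rewrite twoN (_ : _ @^-1` _ = `[0, 1]%classic) => [->|]; last first.
  by apply/seteqP; split => t /=; rewrite !in_itv/= => /andP[? ?];
    apply/andP; split; lra.
rewrite -mulrDr; congr (_ * _).
have int2' : (@lebesgue_measure R).-integrable `]2^-1, 1] (EFin \o F).
  by apply: integrableS int2 => //; apply: subset_itvr; rewrite bnd_simp.
rewrite -(Rintegral_itv_obnd_cbnd int2').
rewrite -(Rintegral_itvB intF) ?bnd_simp; [ring|lra|lra].
Qed.

(** A whole diagonal is not contained in any of the tetrahedra, so [integrable_tetra_path] does not
    cover it. *)
Lemma integrable_cube_path {R : realType} (c u v w : pt R) (f : pt R -> R)
    (g : R -> pt R) :
  is_cube_frame c u v w ->
  (forall fr, fr \in frames u v w -> convex_on (tetra c fr.1.1 fr.1.2 fr.2) f) ->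
  measurable_fun setT g -> (forall t, 0 <= t <= 1 -> cube c u v w (g t)) ->
  (@lebesgue_measure R).-integrable `[0, 1] (EFin \o (f \o g)).
Proof.
move=> frm fconv mg gC; have [N hN] := cube_bounded _ _ _ _ frm f fconv.
have leb1 : (lebesgue_measure `[0%R, 1%R : R]%classic < +oo)%E.
  by rewrite lebesgue_measure_itv/= lte_fin ltr01 sube0 ltry.
apply: (measurable_bounded_integrable (mu := @lebesgue_measure R) (f := f \o g)
  _ leb1).
- exact: measurable_itv.
- apply: (measurable_comp (F := cube c u v w))
    (measurable_fun_cube _ _ _ _ frm f fconv) _.
  + exact: measurable_cube.
  + by move=> _ [t /= + <-]; rewrite in_itv/=; exact: gC.
  + exact: measurable_funTS.
- exists N; split; first exact: num_real.
  move=> x Nx t /=; rewrite in_itv/= => t01.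
  exact: le_trans (hN _ (gC _ t01)) (ltW Nx).
Qed.

(** The edge points have equal first and third coordinates, so two frames share the edge. On the
    half diagonal it is the second and third that agree. *)
Lemma edge_integral_sym {R : realType} (c u v w : pt R) (f : pt R -> R) :
  edge_integral c u v w f = edge_integral c w v u f.
Proof.
apply: eq_Rintegral => t _; congr f.
by rewrite cpt_swap12 cpt_swap23 cpt_swap12.
Qed.

Lemma diag_integral_sym {R : realType} (c u v w : pt R) (f : pt R -> R) :
  diag_integral c u v w f = diag_integral c u w v f.
Proof. by apply: eq_Rintegral => t _; rewrite cpt_swap23. Qed.

Lemma segment_cpt {R : realType} (c u v w : pt R) (x y z x' y' z' t : R) :
  padd (cpt c u v w x y z)
    (pscale t (psub (cpt c u v w x' y' z') (cpt c u v w x y z))) =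
  cpt c u v w (x + t * (x' - x)) (y + t * (y' - y)) (z + t * (z' - z)).
Proof. by rewrite /cpt /psub /padd /pscale /=; congr (_, _, _); ring. Qed.

Lemma plen_cpt {R : realType} (c u v w : pt R) (x y z x' y' z' : R) :
  is_cube_frame c u v w ->
  plen (psub (cpt c u v w x' y' z') (cpt c u v w x y z)) =
  plen u * Num.sqrt ((x' - x) ^+ 2 + (y' - y) ^+ 2 + (z' - z) ^+ 2).
Proof.
move=> [a [a0 [uu [vv [ww [uv [uw vw]]]]]]].
rewrite /plen uu -sqrtrM ?sqr_ge0//; congr Num.sqrt.
transitivity ((x' - x) ^+ 2 * pdot u u + (y' - y) ^+ 2 * pdot v v
  + (z' - z) ^+ 2 * pdot w w + 2 * (x' - x) * (y' - y) * pdot u v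
  + 2 * (x' - x) * (z' - z) * pdot u w + 2 * (y' - y) * (z' - z) * pdot v w).
  by rewrite /pdot /cpt /psub /padd /pscale /=; ring.
by rewrite uu vv ww uv uw vw; ring.
Qed.

(** The middle vector of a frame gives the direction of its edge and the first one selects its half
    diagonal. Negated frames account for the edges at [W] and the other halves. *)
Lemma edges_diagsE {R : realType} (c u v w : pt R) (f : pt R -> R) :
  let u' := pscale (-1) u in let v' := pscale (-1) v in
  let w' := pscale (-1) w in
  edges_diags c u v w f =
  2 * (edge_integral c v u w f + edge_integral c u v w f + edge_integral c u w v f
    + edge_integral c v' u' w' f + edge_integral c u' v' w' f
    + edge_integral c u' w' v' f)
  + 2 * (diag_integral c u v w f + diag_integral c v u w f + diag_integral c w u v f
    + diag_integral c u' v' w' f + diag_integral c v' u' w' f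
    + diag_integral c w' u' v' f).
Proof.
move=> u' v' w'; rewrite /edges_diags !big_ord_recl big_ord0 /frame_nth /=.
rewrite -/u' -/v' -/w'.
rewrite (edge_integral_sym c w u v) (edge_integral_sym c w v u).
rewrite (edge_integral_sym c v w u).
rewrite (edge_integral_sym c w' u' v') (edge_integral_sym c w' v' u').
rewrite (edge_integral_sym c v' w' u').
rewrite (diag_integral_sym c u w v) (diag_integral_sym c v w u).
rewrite (diag_integral_sym c w v u).
rewrite (diag_integral_sym c u' w' v') (diag_integral_sym c v' w' u').
rewrite (diag_integral_sym c w' v' u').
ring.
Qed.

Lemma diagonal_integral {R : realType} (c u v w : pt R) (f : pt R -> R) :
  is_cube_frame c u v w ->
  (forall fr, fr \in frames u v w -> convex_on (tetra c fr.1.1 fr.1.2 fr.2) f) ->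
  forall x y z : R, (x = 1 \/ x = -1) -> (y = 1 \/ y = -1) -> (z = 1 \/ z = -1) ->
  2 * \int[@lebesgue_measure R]_(t in `[0, 1])
    f (cpt c u v w (x + t * (- x - x)) (y + t * (- y - y)) (z + t * (- z - z))) =
  \int[@lebesgue_measure R]_(t in `[0, 1]) f (cpt c u v w (- x * t) (- y * t) (- z * t)) +
  \int[@lebesgue_measure R]_(t in `[0, 1]) f (cpt c u v w (x * t) (y * t) (z * t)).
Proof.
move=> frm fconv x y z hx hy hz.
rewrite -(Rintegral_halves (fun t => f (cpt c u v w (x + t * (- x - x))
  (y + t * (- y - y)) (z + t * (- z - z))))).
  congr (_ + _); apply: eq_Rintegral => t _; congr f;
    by rewrite /cpt /padd /pscale /=; congr (_, _, _); field.
apply: (integrable_cube_path c u v w f (fun t => cpt c u v w (x + t * (- x - x))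
  (y + t * (- y - y)) (z + t * (- z - z))) frm fconv).
  apply: (measurableT_comp (measurable_frame_map c u v w) (g := fun t : R =>
    (x + t * (- x - x), y + t * (- y - y), z + t * (- z - z)) : pt R)).
  by apply: measurable_pt_fun => /=; apply: measurable_funD => //;
    exact: measurable_funM.
have bnd (s t : R) : 0 <= t <= 1 -> s = 1 \/ s = -1 -> -1 <= s + t * (- s - s) <= 1.
  by move=> /andP[? ?] [|] ->; apply/andP; split; lra.
by move=> t t01; exists (x + t * (- x - x)), (y + t * (- y - y)), (z + t * (- z - z));
  split => //; exact: bnd.
Qed.

(** * Averages over the cube, the edges and the diagonals *)

(** After [cube_integral_le] only an identity remains: [edges_diags] equals 12 times the average
    over the edges plus 12 times the average over the diagonals, and is divided by 24. *)
Lemma avg_cube_le {R : realType} (c u v w : pt R) (f : pt R -> R) :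
  is_cube_frame c u v w ->
  (forall fr, fr \in frames u v w -> convex_on (tetra c fr.1.1 fr.1.2 fr.2) f) ->
  let P x y z := cpt c u v w x y z in
  avg_vol f (cube c u v w) <=
  2^-1 * avg_segs f [:: (P 1 1 1, P (-1) 1 1); (P 1 1 1, P 1 (-1) 1);
    (P 1 1 1, P 1 1 (-1)); (P (-1) (-1) (-1), P 1 (-1) (-1));
    (P (-1) (-1) (-1), P (-1) 1 (-1)); (P (-1) (-1) (-1), P (-1) (-1) 1)] +
  2^-1 * avg_segs f [:: (P (-1) 1 1, P 1 (-1) (-1)); (P 1 (-1) 1, P (-1) 1 (-1));
    (P 1 1 (-1), P (-1) (-1) 1)].
Proof.
move=> frm fconv; cbv zeta.
have [k k0 kE] := leb3_frame_map _ _ _ _ frm.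
have volE := leb3_cube c u v w k frm k0 kE.
have L0 : 0 < plen u.
  by case: (frm) => a [a0 [uu _]]; rewrite /plen uu sqrtr_gt0 exprn_gt0.
have vol0 : 0 < fine (leb3 (cube c u v w)) by rewrite volE divr_gt0.
have le_vol : avg_vol f (cube c u v w) <= edges_diags c u v w f / 24.
  rewrite /avg_vol ler_pdivrMr//; apply: le_trans (cube_integral_le _ _ _ _ frm f fconv) _.
  by rewrite le_eqVlt; apply/orP; left; apply/eqP; field.
apply: le_trans le_vol _.
pose u' := pscale (-1) u; pose v' := pscale (-1) v; pose w' := pscale (-1) w.
pose segs x y z x' y' z' := \int[@lebesgue_measure R]_(t in `[0, 1])
  f (cpt c u v w (x + t * (x' - x)) (y + t * (y' - y)) (z + t * (z' - z))).
have segE x y z x' y' z' : seg_integral f (cpt c u v w x y z) (cpt c u v w x' y' z') =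
    plen u * Num.sqrt ((x' - x) ^+ 2 + (y' - y) ^+ 2 + (z' - z) ^+ 2) *
    segs x y z x' y' z'.
  rewrite /seg_integral plen_cpt//; congr (_ * _).
  by apply: eq_Rintegral => t _; rewrite segment_cpt.
have E1 : segs 1 1 1 (-1) 1 1 = edge_integral c v u w f.
  apply: eq_Rintegral => t _; congr f.
  by rewrite /cpt /padd /pscale /=; congr (_, _, _); ring.
have E2 : segs 1 1 1 1 (-1) 1 = edge_integral c u v w f.
  apply: eq_Rintegral => t _; congr f.
  by rewrite /cpt /padd /pscale /=; congr (_, _, _); ring.
have E3 : segs 1 1 1 1 1 (-1) = edge_integral c u w v f.
  apply: eq_Rintegral => t _; congr f.
  by rewrite /cpt /padd /pscale /=; congr (_, _, _); ring.
have E4 : segs (-1) (-1) (-1) 1 (-1) (-1) = edge_integral c v' u' w' f.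
  apply: eq_Rintegral => t _; congr f.
  by rewrite /cpt /padd /pscale /=; congr (_, _, _); ring.
have E5 : segs (-1) (-1) (-1) (-1) 1 (-1) = edge_integral c u' v' w' f.
  apply: eq_Rintegral => t _; congr f.
  by rewrite /cpt /padd /pscale /=; congr (_, _, _); ring.
have E6 : segs (-1) (-1) (-1) (-1) (-1) 1 = edge_integral c u' w' v' f.
  apply: eq_Rintegral => t _; congr f.
  by rewrite /cpt /padd /pscale /=; congr (_, _, _); ring.
have p1 : 1 = 1 :> R \/ 1 = -1 :> R by left.
have m1 : -1 = 1 :> R \/ -1 = -1 :> R by right.
have D1 : 2 * segs (-1) 1 1 1 (-1) (-1) =
    diag_integral c u v w f + diag_integral c u' v' w' f.
  have := diagonal_integral c u v w f frm fconv _ _ _ m1 p1 p1.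
  rewrite /segs !opprK => ->; congr (_ + _); apply: eq_Rintegral => t _; congr f;
    by rewrite /cpt /padd /pscale /=; congr (_, _, _); ring.
have D2 : 2 * segs 1 (-1) 1 (-1) 1 (-1) =
    diag_integral c v u w f + diag_integral c v' u' w' f.
  have := diagonal_integral c u v w f frm fconv _ _ _ p1 m1 p1.
  rewrite /segs !opprK => ->; congr (_ + _); apply: eq_Rintegral => t _; congr f;
    by rewrite /cpt /padd /pscale /=; congr (_, _, _); ring.
have D3 : 2 * segs 1 1 (-1) (-1) (-1) 1 =
    diag_integral c w u v f + diag_integral c w' u' v' f.
  have := diagonal_integral c u v w f frm fconv _ _ _ p1 p1 m1.
  rewrite /segs !opprK => ->; congr (_ + _); apply: eq_Rintegral => t _; congr f;
    by rewrite /cpt /padd /pscale /=; congr (_, _, _); ring.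
rewrite /avg_segs !big_cons !big_nil /= !segE !plen_cpt//.
rewrite E1 E2 E3 E4 E5 E6.
have q1 : (-1 - 1) ^+ 2 + (1 - 1) ^+ 2 + (1 - 1) ^+ 2 = 4 :> R by ring.
have q2 : (1 - 1) ^+ 2 + (-1 - 1) ^+ 2 + (1 - 1) ^+ 2 = 4 :> R by ring.
have q3 : (1 - 1) ^+ 2 + (1 - 1) ^+ 2 + (-1 - 1) ^+ 2 = 4 :> R by ring.
have q4 : (1 - -1) ^+ 2 + (-1 - -1) ^+ 2 + (-1 - -1) ^+ 2 = 4 :> R by ring.
have q5 : (-1 - -1) ^+ 2 + (1 - -1) ^+ 2 + (-1 - -1) ^+ 2 = 4 :> R by ring.
have q6 : (-1 - -1) ^+ 2 + (-1 - -1) ^+ 2 + (1 - -1) ^+ 2 = 4 :> R by ring.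
have q7 : (1 - -1) ^+ 2 + (-1 - 1) ^+ 2 + (-1 - 1) ^+ 2 = 12 :> R by ring.
have q8 : (-1 - 1) ^+ 2 + (1 - -1) ^+ 2 + (-1 - 1) ^+ 2 = 12 :> R by ring.
have q9 : (-1 - 1) ^+ 2 + (-1 - 1) ^+ 2 + (1 - -1) ^+ 2 = 12 :> R by ring.
rewrite q1 q2 q3 q4 q5 q6 q7 q8 q9.
have r4 : 0 < Num.sqrt 4 :> R by rewrite sqrtr_gt0.
have r12 : 0 < Num.sqrt 12 :> R by rewrite sqrtr_gt0.
rewrite edges_diagsE -/u' -/v' -/w' le_eqVlt; apply/orP; left; apply/eqP.
move: D1 D2 D3.
move: (segs (-1) 1 1 1 (-1) (-1)) (segs 1 (-1) 1 (-1) 1 (-1)) (segs 1 1 (-1) (-1) (-1) 1).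
move=> d1 d2 d3 D1 D2 D3.
(* Segments within each family have the same length, [l * r] or [l * q], so only its positivity
   matters: it cancels in the average. *)
set r := Num.sqrt 4; set q := Num.sqrt 12; set l := plen u.
have cancel6 (x1 x2 x3 x4 x5 x6 : R) : (l * r * x1 + (l * r * x2 + (l * r * x3 +
    (l * r * x4 + (l * r * x5 + (l * r * x6 + 0)))))) /
    (l * r + (l * r + (l * r + (l * r + (l * r + (l * r + 0)))))) =
    (x1 + x2 + x3 + x4 + x5 + x6) / 6.
  have : 0 < l * r by rewrite mulr_gt0.
  by move: (l * r) => m m0; field; rewrite gt_eqF//; lra.
have cancel3 (x1 x2 x3 : R) : (l * q * x1 + (l * q * x2 + (l * q * x3 + 0))) /
    (l * q + (l * q + (l * q + 0))) = (x1 + x2 + x3) / 3.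
  have : 0 < l * q by rewrite mulr_gt0.
  by move: (l * q) => m m0; field; rewrite gt_eqF//; lra.
rewrite cancel6 cancel3; lra.
Qed.

Theorem theorem8p2 (R : realType) (c e1 e2 e3 : pt R) (f : pt R -> R)
    (s1 s2 s3 : R) :
  is_cube_frame c e1 e2 e3 ->
  (forall (i : 'I_3) (sg : R), (sg = 1 \/ sg = -1) ->
     convex_on (pyramid c (cube_face c e1 e2 e3 i sg)) f) ->
  (s1 = 1 \/ s1 = -1) -> (s2 = 1 \/ s2 = -1) -> (s3 = 1 \/ s3 = -1) ->
  let V := cpt c e1 e2 e3 s1 s2 s3 in
  let W := cpt c e1 e2 e3 (- s1) (- s2) (- s3) in
  let V1 := cpt c e1 e2 e3 (- s1) s2 s3 in
  let V2 := cpt c e1 e2 e3 s1 (- s2) s3 in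
  let V3 := cpt c e1 e2 e3 s1 s2 (- s3) in
  let W1 := cpt c e1 e2 e3 s1 (- s2) (- s3) in
  let W2 := cpt c e1 e2 e3 (- s1) s2 (- s3) in
  let W3 := cpt c e1 e2 e3 (- s1) (- s2) s3 in
  let S := [:: (V, V1); (V, V2); (V, V3); (W, W1); (W, W2); (W, W3)] in
  let Q := [:: (V1, W1); (V2, W2); (V3, W3)] in
  avg_vol f (cube c e1 e2 e3) <= 2^-1 * avg_segs f S + 2^-1 * avg_segs f Q.
Proof.
move=> frm0 fconv h1 h2 h3; cbv zeta.
(* Absorbing the signs into the frame moves [V] to coordinates [(1, 1, 1)] without changing the cube
   or its faces. *)
pose u := pscale s1 e1; pose v := pscale s2 e2; pose w := pscale s3 e3.
have frm : is_cube_frame c u v w by exact: is_cube_frame_sign.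
have vert (x y z : R) :
    cpt c u v w x y z = cpt c e1 e2 e3 (x * s1) (y * s2) (z * s3).
  exact: cpt_scale.
have tconv fr : fr \in frames u v w -> convex_on (tetra c fr.1.1 fr.1.2 fr.2) f.
  move=> frin; apply: (convex_on_tetra c e1 e2 e3) => //.
    by case: (framesP _ _ _ _ _ frm frin).
  by apply: in_faces_frames frin; exact: in_faces_sign.
have := avg_cube_le c u v w f frm tconv; cbv zeta.
by rewrite cube_sign// !vert !mul1r !mulN1r.
Qed.
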